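(* Let $\mathbb{A}(\mathcal{M})=\mathbb{A}_\chi(\mathcal{M})$ be a $\chi$-algebra on a simple matroid $\mathcal{M}$ on $[n]$ and let $x\in[n]$. Then $$0\to\mathbb{A}(\mathcal{M}\setminus x)\xrightarrow{\ \mathfrak{i}_x\ }\mathbb{A}(\mathcal{M})\xrightarrow{\ \mathfrak{p}_x\ }\mathbb{A}(\mathcal{M}/x)\to0$$ is a split short exact sequence of vector spaces.
   Context: $\mathcal{M}$ is a matroid on $[n]=\{1,\dots,n\}$ and $\mathbb{K}$ a field. $\mathcal{E}$ is the graded $\mathbb{K}$-algebra generated by $1,e_1,\dots,e_n$ subject to $e_i^2=0$ and $e_je_i=\beta_{i,j}e_ie_j$ for $i<j$ ($\beta_{i,j}\in\mathbb{K}\setminus0$ fixed). For $X=\{i_1<\dots<i_m\}$, $e_X=e_{i_1}\cdots e_{i_m}$. Ordered sets $X^\sigma$ are listings of $X$ (unordered sets taken increasingly), $*$ is concatenation, and $\chi:2^{[n]}\to\mathbb{K}$ is extended by $\chi(X^\sigma)=\mathrm{sgn}(\sigma)\chi(X)$. The $\chi$-boundary is $\partial e_X=\sum_{p=1}^m(-1)^p\chi(X\setminus i_p)e_{X\setminus i_p}$. A unidependent is a set containing exactly one circuit. $\Im_\chi(\mathcal{M})$ is the right ideal generated by $\partial e_C$ ($C$ a circuit, $|C|>1$) and $e_i$ ($i$ a loop); $\mathbb{A}_\chi(\mathcal{M})=\mathcal{E}/\Im_\chi(\mathcal{M})$ is a $\chi$-algebra if (UC1) $\chi(I)\ne0$ iff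 $I$ independent and (UC2) for unidependents $U'\subseteq U$ there is $\varepsilon_{U,U'}\ne0$ with $\partial e_U=\varepsilon_{U,U'}(\partial e_{U'})e_{U\setminus U'}$. Classes are again written $e_X$. Here $\mathbb{A}(\mathcal{M}\setminus x)=\mathbb{A}_{\chi'}(\mathcal{M}\setminus x)$ with $\chi'(I)=\chi(I)$, and $\mathbb{A}(\mathcal{M}/x)=\mathbb{A}_{\chi''}(\mathcal{M}/x)$ with $\chi''(I)=\chi(I*x)$, both built from the subalgebra generated by $e_i$, $i\ne x$ (these are $\chi$-algebras). $\mathfrak{i}_x$ is the unique linear map with $\mathfrak{i}_x(e_I)=e_I$ for $I$ independent in $\mathcal{M}\setminus x$. $\mathfrak{p}_x$ is the unique linear map with, for $I$ independent in $\mathcal{M}$: $\mathfrak{p}_x(e_I)=e_{I\setminus x}$ if $x\in I$; $\mathfrak{p}_x(e_I)=\frac{\chi((I\setminus y)*x)}{\chi((I\setminus y)*y)}e_{I\setminus y}$ if some $y\in I$ is parallel to $x$ (i.e. $\{x,y\}$ is a circuit); and $\mathfrak{p}_x(e_I)=0$ otherwise. *)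

(* Defs.v *)
From HB Require Import structures.
From mathcomp Require Import all_boot all_order all_algebra all_field.
Set Implicit Arguments.
Unset Strict Implicit.
Unset Printing Implicit Defensive.
Import GRing.Theory.
Local Open Scope ring_scope.

(* Matroids whose ground set is a subset of a fixed finite type, so that      *)
(* minors live over the same type.                                            *)

Record matroid (T : finType) := Matroid {
  ground : {set T};
  indep : pred {set T};
  indep_ground : forall I, indep I -> I \subset ground;
  indep_set0 : indep set0;
  indep_subset : forall I J : {set T}, J \subset I -> indep I -> indep J;
  indep_augment : forall I J : {set T}, indep I -> indep J -> (#|I| < #|J|)%N ->
    exists2 y, y \in J :\: I & indep (y |: I)
}.

Section MatroidTheory.
Variables (T : finType) (M : matroid T).
Implicit Types (x y : T) (C I J U : {set T}).

Definition dependent U := (U \subset ground M) && ~~ indep M U.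
Definition circuit C := minset dependent C.
Definition loop x := circuit [set x].
Definition parallel x y := (x != y) && circuit [set x; y].

Definition simple_matroid :=
  (forall x, ~~ loop x) /\ (forall x y, ~~ parallel x y).

Definition unidependent U :=
  (U \subset ground M) && (#|[set C | circuit C && (C \subset U)]| == 1%N).

Definition del_indep x I := (x \notin I) && indep M I.

Lemma del_indep_ground x I : del_indep x I -> I \subset ground M :\ x.
Proof. by case/andP=> xI /indep_ground sI; rewrite subsetD1 sI. Qed.

Lemma del_indep_set0 x : del_indep x set0.
Proof. by rewrite /del_indep inE indep_set0. Qed.

Lemma del_indep_subset x I J : J \subset I -> del_indep x I -> del_indep x J.
Proof.
move=> sJI /andP[xI hI]; rewrite /del_indep (indep_subset sJI hI) andbT.
by apply: contra xI; apply: (subsetP sJI).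
Qed.

Lemma del_indep_augment x I J :
    del_indep x I -> del_indep x J -> (#|I| < #|J|)%N ->
  exists2 y, y \in J :\: I & del_indep x (y |: I).
Proof.
case/andP=> xI hI /andP[xJ hJ] /(indep_augment hI hJ)[y yJ hy].
exists y => //; rewrite /del_indep hy andbT !inE negb_or xI andbT.
by apply: contraNneq xJ => ->; case/setDP: yJ.
Qed.

Definition deletion x : matroid T :=
  Matroid (@del_indep_ground x) (@del_indep_set0 x) (@del_indep_subset x)
          (@del_indep_augment x).

(* When x is a loop (or is outside the ground set), M / x = M \ x. *)
Definition contr_indep x I :=
  (x \notin I) && indep M (if indep M [set x] then x |: I else I).

Lemma contr_indep_ground x I : contr_indep x I -> I \subset ground M :\ x.
Proof.
case/andP=> xI hI; rewrite subsetD1 xI andbT.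
by case: ifP hI => _ /indep_ground //; rewrite subUset => /andP[].
Qed.

Lemma contr_indep_set0 x : contr_indep x set0.
Proof.
by rewrite /contr_indep inE /=; case: ifP => [|_]; rewrite ?setU0 ?indep_set0.
Qed.

Lemma contr_indep_subset x I J :
  J \subset I -> contr_indep x I -> contr_indep x J.
Proof.
move=> sJI /andP[xI hI]; rewrite /contr_indep; apply/andP; split.
  by apply: contra xI; apply: (subsetP sJI).
by case: ifP hI => _; apply: indep_subset; rewrite ?setUS.
Qed.

Lemma contr_indep_augment x I J :
    contr_indep x I -> contr_indep x J -> (#|I| < #|J|)%N ->
  exists2 y, y \in J :\: I & contr_indep x (y |: I).
Proof.
rewrite /contr_indep; case: ifP => _; last exact: del_indep_augment.
case/andP=> xI hI /andP[xJ hJ] ltIJ.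
have lt' : (#|x |: I| < #|x |: J|)%N by rewrite !cardsU1 xI xJ.
have [y yJ hy] := indep_augment hI hJ lt'.
move: yJ; rewrite !inE negb_or => /andP[/andP[yx yI]]; rewrite (negPf yx) /= => yJ.
exists y; first by rewrite !inE yI.
by rewrite !inE negb_or eq_sym yx xI /= setUCA.
Qed.

Definition contraction x : matroid T :=
  Matroid (@contr_indep_ground x) (@contr_indep_set0 x) (@contr_indep_subset x)
          (@contr_indep_augment x).

End MatroidTheory.

(* The algebra with generators e_i and relations e_i^2 = 0 and                *)
(* e_j e_i = beta i j e_i e_j for i < j. It is built on its basis of          *)
(* square-free monomials; qext_presentation shows that it has the universal   *)
(* property of this presentation.                                             *)

Definition qext (n : nat) (K : fieldType) (beta : 'I_n -> 'I_n -> K) : Type :=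
  {ffun {set 'I_n} -> K^o}.

Section QuantumExterior.
Variables (n : nat) (K : fieldType) (beta : 'I_n -> 'I_n -> K).
Local Notation E := (qext beta).
Implicit Types (X Y Z : {set 'I_n}) (a b c : E).

HB.instance Definition _ := Vector.copy E {ffun {set 'I_n} -> K^o}.

Definition qmon X : E := [ffun Y => (Y == X)%:R].

Definition qtwist X Y : K := \prod_(j in X) \prod_(i in Y | (i < j)%N) beta i j.

Definition qmonM X Y : E :=
  if [disjoint X & Y] then qtwist X Y *: qmon (X :|: Y) else 0.

Definition qmul a b : E := \sum_X \sum_Y (a X * b Y) *: qmonM X Y.

Lemma qmon_expand a : a = \sum_X a X *: qmon X.
Proof.
apply/ffunP=> Y; rewrite sum_ffunE (bigD1 Y) //= big1 ?addr0 => [|X neXY].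
  by rewrite !ffunE eqxx; apply/esym/mulr1.
by rewrite !ffunE eq_sym (negPf neXY); apply: mulr0.
Qed.

Fact qmulDl : left_distributive qmul +%R.
Proof.
move=> a b c; rewrite /qmul -big_split; apply: eq_bigr => X _ /=.
by rewrite -big_split; apply: eq_bigr => Y _; rewrite ffunE mulrDl scalerDl.
Qed.

Fact qmulDr : right_distributive qmul +%R.
Proof.
move=> c a b; rewrite /qmul -big_split; apply: eq_bigr => X _ /=.
by rewrite -big_split; apply: eq_bigr => Y _; rewrite ffunE mulrDr scalerDl.
Qed.

Fact qmulZl k a b : qmul (k *: a) b = k *: qmul a b.
Proof.
rewrite /qmul scaler_sumr; apply: eq_bigr => X _; rewrite scaler_sumr.
by apply: eq_bigr => Y _; rewrite ffunE scalerA mulrA.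
Qed.

Fact qmulZr k a b : qmul a (k *: b) = k *: qmul a b.
Proof.
rewrite /qmul scaler_sumr; apply: eq_bigr => X _; rewrite scaler_sumr.
apply: eq_bigr => Y _; rewrite ffunE scalerA; congr (_ *: _).
by rewrite -[k *: b Y]/(k * b Y) mulrCA.
Qed.

Fact qmul0l b : qmul 0 b = 0.
Proof. by have := qmulZl 0 0 b; rewrite !scale0r. Qed.

Fact qmul0r b : qmul b 0 = 0.
Proof. by have := qmulZr 0 b 0; rewrite !scale0r. Qed.

Fact qmul_suml (I : finType) (F : I -> E) b :
  qmul (\sum_i F i) b = \sum_i qmul (F i) b.
Proof.
exact: (big_morph (fun a => qmul a b) (fun x y => qmulDl x y b) (qmul0l b)).
Qed.

Fact qmul_sumr (I : finType) (F : I -> E) b :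
  qmul b (\sum_i F i) = \sum_i qmul b (F i).
Proof.
exact: (big_morph (qmul b) (qmulDr b) (qmul0r b)).
Qed.

Lemma qmul_mon X Y : qmul (qmon X) (qmon Y) = qmonM X Y.
Proof.
rewrite /qmul (bigD1 X) //= [X in _ + X]big1 ?addr0 => [|Z neZX].
  rewrite (bigD1 Y) //= big1 ?addr0 => [|Z neZY].
    by rewrite !ffunE !eqxx mulr1 scale1r.
  by rewrite !ffunE (negPf neZY) mulr0 scale0r.
by apply: big1 => T _; rewrite !ffunE (negPf neZX) mul0r scale0r.
Qed.

Fact prod_disjU (F : 'I_n -> K) X Y : [disjoint X & Y] ->
  \prod_(i in X :|: Y) F i = (\prod_(i in X) F i) * \prod_(i in Y) F i.
Proof. by move=> dXY; rewrite -bigU //=; apply: eq_bigl => i; rewrite !inE. Qed.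

Lemma qtwistUl X Y Z :
  [disjoint X & Y] -> qtwist (X :|: Y) Z = qtwist X Z * qtwist Y Z.
Proof. by move=> dXY; rewrite /qtwist prod_disjU. Qed.

Lemma qtwistUr X Y Z :
  [disjoint Y & Z] -> qtwist X (Y :|: Z) = qtwist X Y * qtwist X Z.
Proof.
move=> dYZ; rewrite /qtwist -big_split; apply: eq_bigr => j _ /=.
by rewrite !big_mkcondr /= prod_disjU.
Qed.

Fact disjUl X Y Z : [disjoint X :|: Y & Z] = [disjoint X & Z] && [disjoint Y & Z].
Proof. by rewrite !disjoints_subset subUset. Qed.

Fact disjUr X Y Z : [disjoint X & Y :|: Z] = [disjoint X & Y] && [disjoint X & Z].
Proof. by rewrite !disjoints_subset setCU subsetI. Qed.

Lemma qmonMA X Y Z : qmul (qmon X) (qmonM Y Z) = qmul (qmonM X Y) (qmon Z).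
Proof.
rewrite {1}/qmonM; case: ifPn => dYZ; rewrite [qmonM X Y]/qmonM.
  rewrite qmulZr qmul_mon; case: ifPn => dXY.
    rewrite qmulZl qmul_mon /qmonM disjUl disjUr dXY dYZ andbT /=.
    case: ifP => dXZ; last by rewrite !scaler0.
    by rewrite !scalerA qtwistUl // qtwistUr // setUA mulrC -!mulrA.
  by rewrite qmul0l /qmonM disjUr (negPf dXY) scaler0.
rewrite qmul0r; case: ifPn => dXY; rewrite ?qmul0l //.
by rewrite qmulZl qmul_mon /qmonM disjUl (negPf dYZ) andbF scaler0.
Qed.

Fact qmulA : associative qmul.
Proof.
move=> a b c; rewrite (qmon_expand a).
rewrite (qmul_suml _ (qmul b c)) (qmul_suml _ b) (qmul_suml _ c).
apply: eq_bigr => X _; rewrite !qmulZl; congr (_ *: _).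
rewrite (qmon_expand b) (qmul_suml _ c) !(qmul_sumr _ (qmon X)) (qmul_suml _ c).
apply: eq_bigr => Y _; rewrite qmulZl !qmulZr !qmulZl; congr (_ *: _).
rewrite (qmon_expand c) !(qmul_sumr _ (qmon Y)) !qmul_sumr.
apply: eq_bigr => Z _; rewrite !qmulZr; congr (_ *: _).
by rewrite !qmul_mon qmonMA.
Qed.

Fact qmul1l : left_id (qmon set0) qmul.
Proof.
move=> a; rewrite {2}(qmon_expand a) {1}(qmon_expand a) qmul_sumr.
apply: eq_bigr => X _; rewrite qmulZr qmul_mon /qmonM disjoints_subset sub0set.
by rewrite /qtwist big_set0 scale1r set0U.
Qed.

Fact qmul1r : right_id (qmon set0) qmul.
Proof.
move=> a; rewrite {2}(qmon_expand a) {1}(qmon_expand a) qmul_suml.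
apply: eq_bigr => X _; rewrite qmulZl qmul_mon /qmonM disjoints_subset setC0.
rewrite subsetT setU0 /qtwist big1 ?scale1r // => i _.
by rewrite big_pred0 // => j; rewrite inE.
Qed.

Fact qone_neq0 : qmon set0 != 0.
Proof.
apply/eqP=> /ffunP/(_ set0); rewrite !ffunE eqxx => /eqP.
by rewrite (oner_eq0 K).
Qed.

HB.instance Definition _ := GRing.Zmodule_isNzRing.Build E
  qmulA qmul1l qmul1r qmulDl qmulDr qone_neq0.
HB.instance Definition _ := GRing.Lmodule_isLalgebra.Build K E
  (fun k a b => esym (qmulZl k a b)).
HB.instance Definition _ := GRing.Lalgebra_isAlgebra.Build K E
  (fun k a b => esym (qmulZr k a b)).
HB.instance Definition _ := Algebra_isFalgebra.Build K E.

Definition qgen (i : 'I_n) : E := qmon [set i].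

(* The product is taken in increasing order of the indices. *)
Definition qprod X : E := \prod_(i in X) qgen i.

Definition qrelations (B : algType K) (f : 'I_n -> B) : Prop :=
  (forall i, f i * f i = 0) /\
  (forall i j : 'I_n, (i < j)%N -> f j * f i = beta i j *: (f i * f j)).

Lemma qprod_seq (B : algType K) (f : 'I_n -> B) X :
  \prod_(i in X) f i = \prod_(i <- enum X) f i.
Proof. by rewrite big_filter [index_enum _]unlock. Qed.

Lemma sorted_enum_set X : sorted ltn [seq val i | i <- enum X].
Proof.
apply: (subseq_sorted ltn_trans _ (iota_ltn_sorted 0 n)).
by rewrite -val_enum_ord map_subseq // enumT filter_subseq.
Qed.

Lemma enum_setU1_min (i : 'I_n) X : (forall j, j \in X -> (i < j)%N) ->
  enum (i |: X) = i :: enum X.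
Proof.
move=> lt_iX; apply: (inj_map val_inj); apply: (irr_sorted_eq ltn_trans ltnn).
- exact: sorted_enum_set.
- rewrite /= path_min_sorted ?sorted_enum_set //.
  by apply/allP=> _ /mapP[j jX ->]; apply: lt_iX; rewrite -mem_enum.
- move=> k; apply/mapP/idP => [[j] | ].
    rewrite mem_enum in_setU1 => /predU1P[-> ->|jX ->]; first exact: mem_head.
    by rewrite map_cons in_cons map_f ?orbT // mem_enum.
  rewrite map_cons in_cons => /predU1P[->|/mapP[j jX ->]].
    by exists i; rewrite ?mem_enum ?setU11.
  by exists j; rewrite // mem_enum in_setU1; rewrite mem_enum in jX; rewrite jX orbT.
Qed.

Lemma prod_setU1_min (B : algType K) (f : 'I_n -> B) (i : 'I_n) X :
    (forall j, j \in X -> (i < j)%N) ->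
  \prod_(k in i |: X) f k = f i * \prod_(k in X) f k.
Proof. by move=> lt_iX; rewrite !qprod_seq enum_setU1_min // big_cons. Qed.

Lemma set_min_ind (P : {set 'I_n} -> Prop) : P set0 ->
    (forall (i : 'I_n) X, (forall j, j \in X -> (i < j)%N) -> P X -> P (i |: X)) ->
  forall X, P X.
Proof.
move=> P0 PU X; have [m] := ubnP #|X|; elim: m X => // m IH X ltXm.
have [->|[i0 i0X]] := set_0Vmem X; first exact: P0.
case: (arg_minnP (fun i : 'I_n => val i) i0X) => i iX le_i.
rewrite -(setD1K iX); apply: PU => [j|].
  rewrite !inE => /andP[ne_ji /le_i le_ij].
  by rewrite ltn_neqAle le_ij andbT eq_sym; apply: contra ne_ji => /eqP/val_inj->.
by apply: IH; move: ltXm; rewrite (cardsD1 i) (iX : i \in X).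
Qed.

Lemma qprodE X : qprod X = qmon X.
Proof.
elim/set_min_ind: X => [|i X lt_iX IH]; first by rewrite /qprod big_set0.
rewrite /qprod prod_setU1_min // -/(qprod X) IH.
rewrite -[LHS]/(qmul _ _) qmul_mon /qmonM.
have iX : i \notin X by apply/negP=> /lt_iX; rewrite ltnn.
rewrite disjoints1 iX /qtwist big_set1 big_pred0 ?scale1r // => j.
by apply/negP=> /andP[/lt_iX/ltnW]; rewrite leqNgt => /negPf->.
Qed.

Section Presentation.
Variables (B : algType K) (f : 'I_n -> B) (fR : qrelations f).

Let fp X := \prod_(i in X) f i.

Lemma qrel_genM (j : 'I_n) Y : f j * fp Y =
  if j \in Y then 0
  else (\prod_(i in Y | (i < j)%N) beta i j) *: fp (j |: Y).
Proof.
case: fR => f2 fC; elim/set_min_ind: Y => [|i Y lt_iY IH].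
  rewrite inE /fp big_set0 setU0 big_set1 mulr1 big_pred0 ?scale1r // => i.
  by rewrite inE.
rewrite [fp (i |: Y)]/fp prod_setU1_min // -/(fp Y).
have iY : i \notin Y by apply/negP=> /lt_iY; rewrite ltnn.
rewrite !inE; case: (ltngtP i j) => [lt_ij|lt_ji|/val_inj<-]; last first.
- by rewrite eqxx mulrA f2 mul0r.
- have lt_jY k : k \in i |: Y -> (j < k)%N.
    by rewrite !inE => /predU1P[->|/lt_iY/(ltn_trans lt_ji)].
  have ne_ji : j == i = false by apply/eqP=> ji; rewrite ji ltnn in lt_ji.
  have jY : j \in Y = false.
    by apply/negP=> jY; have := lt_jY j; rewrite !inE jY orbT ltnn => /(_ isT).
  rewrite ne_ji jY /= big_pred0 => [|k]; last first.
    by apply/negP=> /andP[/lt_jY/ltnW]; rewrite leqNgt => /negPf->.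
  by rewrite scale1r /fp prod_setU1_min // prod_setU1_min.
have ne_ji : j == i = false by apply/eqP=> ji; rewrite ji ltnn in lt_ij.
rewrite ne_ji /= mulrA fC // -scalerAl -mulrA IH.
case: ifPn => jY; first by rewrite mulr0 scaler0.
rewrite -scalerAr scalerA setUCA; congr (_ *: _).
  rewrite !big_mkcondr big_setU1 //= lt_ij; congr (_ * _).
rewrite /fp [RHS]prod_setU1_min // => k; rewrite !inE.
by case/predU1P=> [->|/lt_iY].
Qed.

Lemma qrel_monM X Y : fp X * fp Y =
  if [disjoint X & Y] then qtwist X Y *: fp (X :|: Y) else 0.
Proof.
elim/set_min_ind: X => [|i X lt_iX IH].
  by rewrite /fp big_set0 disjoints_subset sub0set /qtwist big_set0 scale1r
             set0U mul1r.
have iX : i \notin X by apply/negP=> /lt_iX; rewrite ltnn.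
rewrite [fp (i |: X)]/fp prod_setU1_min // -/(fp X) -mulrA IH disjUl disjoints1.
case: ifP => dXY; last by rewrite mulr0 andbF.
rewrite -scalerAr qrel_genM inE (negPf iX) /=.
case: ifP => iY /=; first by rewrite scaler0.
rewrite scalerA setUA /qtwist big_setU1 //= mulrC; congr (_ * _ *: _).
apply: eq_bigl => k; rewrite !inE.
case: (boolP (k \in X)) => //= /lt_iX /ltnW; rewrite leqNgt => /negPf->.
by rewrite andbF.
Qed.

Definition qlift (_ : qrelations f) (a : E) : B := \sum_X a X *: fp X.

Lemma qlift_mon X : qlift fR (qmon X) = fp X.
Proof.
rewrite /qlift (bigD1 X) //= big1 ?addr0 => [|Y neYX].
  by rewrite ffunE eqxx scale1r.
by rewrite ffunE (negPf neYX) scale0r.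
Qed.

Fact qlift_linear : linear (qlift fR).
Proof.
move=> k a b; rewrite /qlift scaler_sumr -big_split; apply: eq_bigr => X _ /=.
by rewrite !ffunE scalerDl scalerA.
Qed.
HB.instance Definition _ := GRing.isLinear.Build K E B _ (qlift fR) qlift_linear.

Fact qlift_monoid : monoid_morphism (qlift fR).
Proof.
split=> [|a b]; first by rewrite -[1]/(qmon set0) qlift_mon /fp big_set0.
rewrite -[a * b]/(qmul a b) /qmul linear_sum [qlift fR a]/qlift mulr_suml.
apply: eq_bigr => X _; rewrite linear_sum [qlift fR b]/qlift mulr_sumr.
apply: eq_bigr => Y _; rewrite linearZ /= -scalerAl -scalerAr scalerA qrel_monM.
congr (_ *: _); rewrite /qmonM; case: ifP => _; last exact: linear0.
by rewrite linearZ /= qlift_mon.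
Qed.
HB.instance Definition _ := GRing.isMonoidMorphism.Build E B (qlift fR) qlift_monoid.

End Presentation.

Lemma qgen_relations : qrelations qgen.
Proof.
split=> [i|i j lt_ij]; rewrite -![_ * _]/(qmul _ _) !qmul_mon /qmonM.
  by rewrite disjoints1 inE eqxx.
rewrite !disjoints1 !inE; have [eq_ji|ne_ji] := eqVneq j i.
  by rewrite eq_ji ltnn in lt_ij.
rewrite /= setUC scalerA /qtwist !big_set1; congr (_ *: _).
rewrite (big_pred1 i) => [|k]; last first.
  by rewrite /= inE; case: eqP => // ->.
rewrite big_pred0 ?mulr1 // => k; rewrite inE.
by case: eqP => // ->; apply/negbTE; rewrite -leqNgt ltnW.
Qed.

Theorem qext_presentation (B : algType K) (f : 'I_n -> B) : qrelations f ->
  exists2 phi : {lrmorphism E -> B}, (forall i, phi (qgen i) = f i) &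
    forall psi : {lrmorphism E -> B}, (forall i, psi (qgen i) = f i) -> psi =1 phi.
Proof.
move=> fR; exists (qlift fR : {lrmorphism E -> B}) => [i|psi psiE a] /=.
  by rewrite qlift_mon big_set1.
rewrite {1}(qmon_expand a) linear_sum; apply: eq_bigr => X _.
rewrite linearZ -qprodE /qprod rmorph_prod; congr (_ *: _).
by apply: eq_bigr => i _; apply: psiE.
Qed.

End QuantumExterior.

Arguments qgen {n K} beta i.
Arguments qprod {n K} beta X.

Section QuotientSpace.
Variables (K : fieldType) (V : vectType K) (J : {vspace V}).
Local Open Scope quotient_scope.

Definition quotv : Type := Quotient.quot (pred_of_vspace J : zmodClosed V).

HB.instance Definition _ := GRing.Zmodule.on quotv.

Definition quotv_pi (v : V) : quotv := \pi_quotv v.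

Lemma quotv_piP u v : reflect (quotv_pi u = quotv_pi v) (u - v \in J).
Proof. by rewrite Quotient.idealrBE; apply: eqP. Qed.

Lemma quotv_pi_surj (q : quotv) : exists v, q = quotv_pi v.
Proof. by exists (repr q); rewrite /quotv_pi reprK. Qed.

Fact quotv_piD u v : quotv_pi (u + v) = quotv_pi u + quotv_pi v.
Proof. by rewrite /quotv_pi !piE. Qed.

Definition quotv_scale (k : K) (q : quotv) : quotv := quotv_pi (k *: repr q).

Fact quotv_piZ k v : quotv_pi (k *: v) = quotv_scale k (quotv_pi v).
Proof.
apply/quotv_piP; rewrite -scalerBr memvZ //; apply/quotv_piP.
by rewrite /quotv_pi reprK.
Qed.

Fact quotv_scaleA a b q : quotv_scale a (quotv_scale b q) = quotv_scale (a * b) q.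
Proof.
by have [v ->] := quotv_pi_surj q; rewrite -!quotv_piZ scalerA.
Qed.

Fact quotv_scale1 : left_id 1 quotv_scale.
Proof. by move=> q; have [v ->] := quotv_pi_surj q; rewrite -quotv_piZ scale1r. Qed.

Fact quotv_scaleDr : right_distributive quotv_scale +%R.
Proof.
move=> k p q; have [u ->] := quotv_pi_surj p; have [v ->] := quotv_pi_surj q.
by rewrite -quotv_piD -!quotv_piZ -quotv_piD scalerDr.
Qed.

Fact quotv_scaleDl q : {morph quotv_scale^~ q : a b / a + b}.
Proof.
move=> a b; have [v ->] := quotv_pi_surj q.
by rewrite -!quotv_piZ -quotv_piD scalerDl.
Qed.

HB.instance Definition _ := GRing.Zmodule_isLmodule.Build K quotv
  quotv_scaleA quotv_scale1 quotv_scaleDr quotv_scaleDl.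

Fact quotv_pi_linear : linear quotv_pi.
Proof. by move=> k u v; rewrite quotv_piD quotv_piZ. Qed.

HB.instance Definition _ :=
  GRing.isLinear.Build K V quotv _ quotv_pi quotv_pi_linear.

End QuotientSpace.

Section ChiAlgebra.
Variables (n : nat) (K : fieldType) (beta : 'I_n -> 'I_n -> K).
Local Notation E := (qext beta).
Implicit Types (M : matroid 'I_n) (chi : {set 'I_n} -> K) (I X U : {set 'I_n}).

Fixpoint inversions (s : seq 'I_n) : nat :=
  if s is i :: s' then (count (fun j : 'I_n => (j < i)%N) s' + inversions s')%N
  else 0%N.

(* Extension of chi to listings (duplicate-free sequences) s. *)
Definition chi_list chi (s : seq 'I_n) : K :=
  (-1) ^+ inversions s * chi [set i in s].

(* chi (I * x), where I is listed increasingly, as enum does. *)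
Definition chi_rcons chi I (x : 'I_n) : K := chi_list chi (rcons (enum I) x).

(* enum_val p is the element i_(p+1) of X = {i_1 < ... < i_m}. *)
Definition chi_boundary chi X : E :=
  \sum_(p < #|X|)
    ((-1) ^+ p.+1 * chi (X :\ enum_val p)) *: qprod beta (X :\ enum_val p).

Definition is_chi_algebra M chi : Prop :=
  (forall I, I \subset ground M -> (chi I != 0 <-> indep M I)) /\
  (forall U U', unidependent M U -> unidependent M U' -> U' \subset U ->
     exists2 eps : K, eps != 0 &
       chi_boundary chi U = eps *: (chi_boundary chi U' * qprod beta (U :\: U'))).

Definition gen_subalg (S : {set 'I_n}) : {aspace E} :=
  << <<[seq qgen beta i | i in S]>> >>%AS.

Definition chi_ideal_gens M chi : seq E :=
  [seq chi_boundary chi C | C : {set 'I_n} in [pred C | circuit M C && (1 < #|C|)%N]]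
    ++ [seq qgen beta i | i in loop M].

(* The right ideal of gen_subalg (ground M) generated by chi_ideal_gens. *)
Definition chi_ideal M chi : {vspace E} :=
  (<<chi_ideal_gens M chi>> * gen_subalg (ground M))%VS.

Definition chi_alg M chi : Type :=
  quotv (linfun (@vsval _ _ (gen_subalg (ground M))) @^-1: chi_ideal M chi)%VS.

HB.instance Definition _ M chi := GRing.Lmodule.on (chi_alg M chi).

(* The class of e_X, for X a subset of ground M. *)
Definition chi_class M chi X : chi_alg M chi :=
  quotv_pi _ (vsproj (gen_subalg (ground M)) (qprod beta X)).

Definition del_alg M chi (x : 'I_n) : Type := chi_alg (deletion M x) chi.

Definition contr_chi chi (x : 'I_n) : {set 'I_n} -> K := fun I => chi_rcons chi I x.

Definition contr_alg M chi (x : 'I_n) : Type :=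
  chi_alg (contraction M x) (contr_chi chi x).

HB.instance Definition _ M chi x := GRing.Lmodule.on (del_alg M chi x).
HB.instance Definition _ M chi x := GRing.Lmodule.on (contr_alg M chi x).

Definition is_inclusion M chi (x : 'I_n) (i : del_alg M chi x -> chi_alg M chi) :=
  forall I, indep (deletion M x) I ->
    i (chi_class (deletion M x) chi I) = chi_class M chi I.

Definition is_projection M chi (x : 'I_n)
    (p : chi_alg M chi -> contr_alg M chi x) :=
  let e'' := chi_class (contraction M x) (contr_chi chi x) in
  forall I, indep M I ->
  [/\ x \in I -> p (chi_class M chi I) = e'' (I :\ x),
      forall y, x \notin I -> y \in I -> parallel M x y ->
        p (chi_class M chi I) =
          (chi_rcons chi (I :\ y) x / chi_rcons chi (I :\ y) y) *: e'' (I :\ y)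
    & x \notin I -> (forall y, y \in I -> ~~ parallel M x y) ->
        p (chi_class M chi I) = 0].

End ChiAlgebra.

Definition unique_linear (K : fieldType) (U V : lmodType K) (P : (U -> V) -> Prop) :=
  exists2 f : {linear U -> V}, P f &
    forall g : {linear U -> V}, P g -> g =1 f.

Definition split_short_exact (K : fieldType) (U V W : lmodType K)
    (i : {linear U -> V}) (p : {linear V -> W}) : Prop :=
  [/\ injective i,
      forall v, p v = 0 <-> exists u, v = i u,
      forall w, exists v, p v = w
    & exists s : {linear W -> V}, forall w, p (s w) = w].

(* Main.v *)
Require Import Defs.
From HB Require Import structures.
From mathcomp Require Import all_boot all_order all_fingroup all_algebra all_field.
Set Implicit Arguments.
Unset Strict Implicit.
Unset Printing Implicit Defensive.
Import GRing.Theory.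
Local Open Scope ring_scope.

(** Rescaling [e_I] by [chi I] turns the [chi]-boundary into the simplicial one.
    By (UC2), the ideal of a loopless [chi]-algebra is the span of the [e_D] and
    the [∂ e_U], for [D] and [U] dependent.  In this form it is immediate that
    [e_X |-> e_(X \ x)] induces a surjection onto the algebra of [M / x], which
    itself satisfies (UC2), and that its kernel comes from [M \ x].

    Injectivity of the inclusion uses the no-broken-circuit sets of [M \ x].
    They span the algebra of [M \ x], so it suffices to separate them by linear
    forms on the algebra of [M].  A flag of flats [F_1 ⊃ ... ⊃ F_k] of [M] gives
    such a form, [e_J |-> chi(J)^-1 det [j_b ∈ F_a]]: this determinant vanishes
    for [J] dependent, and by Laplace expansion the boundary of [U] is sent to
    the determinant of [U] for the flag extended by the whole ground set.  The
    flags [F_a = cl {i_a, ..., i_k}] for [I = {i_1 < ... < i_k}] without broken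
    circuit yield the basis dual to the [e_I], up to scalars. *)

(** * Matroids *)

Section MatroidFacts.
Variables (T : finType) (M : matroid T).
Implicit Types (x y z : T) (C D I J S U : {set T}).

Lemma dependent_sup D U :
  U \subset ground M -> D \subset U -> dependent M D -> dependent M U.
Proof.
move=> sU sDU /andP[_ nD]; rewrite /dependent sU /=.
by apply: contra nD; apply: indep_subset.
Qed.

Lemma dependentPn U : U \subset ground M -> dependent M U = ~~ indep M U.
Proof. by rewrite /dependent => ->. Qed.

(** Augmentation is iterated until the size of [J] is reached. The bound [V \subset S :|: J] keeps
    track of where the new elements come from. *)
Lemma indep_extend S J : indep M S -> indep M J -> (#|S| <= #|J|)%N ->
  exists V : {set T},
    [/\ indep M V, S \subset V, V \subset S :|: J & #|V| = #|J|].
Proof.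
move=> hS hJ; have [m] := ubnP (#|J| - #|S|)%N.
elim: m S hS => // m IH S hS ltm leSJ.
have [eSJ|neSJ] := eqVneq #|S| #|J|.
  by exists S; split; rewrite ?subsetUl.
have ltSJ : (#|S| < #|J|)%N by rewrite ltn_neqAle neSJ.
have [y /setDP[yJ yS] hy] := indep_augment hS hJ ltSJ.
have cy : #|y |: S| = #|S|.+1 by rewrite cardsU1 yS.
have [||V [hV sV sVJ cV]] := IH _ hy; rewrite ?cy //.
  by rewrite subnS; case: (#|J| - #|S|)%N (subn_gt0 #|S| #|J|) ltm;
    rewrite ?ltSJ // => k _; rewrite ltnS.
exists V; split=> //; first exact: subset_trans (subsetUr _ _) sV.
apply: subset_trans sVJ _; rewrite !subUset subsetUr subsetUl !andbT.
by rewrite sub1set inE yJ orbT.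
Qed.

Lemma dependent_circuit U : dependent M U ->
  exists2 C, circuit M C & C \subset U.
Proof. by case/minset_exists => C; exists C. Qed.

Lemma circuit_dependent C : circuit M C -> dependent M C.
Proof. by case/minsetP. Qed.

Lemma circuit_neq0 C : circuit M C -> C != set0.
Proof.
move/circuit_dependent/andP=> [_]; apply: contraNneq => ->.
exact: indep_set0.
Qed.

Lemma circuitD1_indep C x : circuit M C -> x \in C -> indep M (C :\ x).
Proof.
move=> circC xC; have /andP[sC _] := circuit_dependent circC.
apply/idPn => nI; have sD := subD1set C x.
have dep : dependent M (C :\ x) by rewrite /dependent (subset_trans sD).
case/minsetP: circC => _ /(_ _ dep sD) eC.
by move: xC; rewrite -eC !inE eqxx.
Qed.

(** The right-hand side does not mention [C], so any two circuits inside [U] coincide. If [v] lies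
    in [C], then [C :\ v] grows inside [U] to an independent [V] with [#|U| - 1] elements; [V]
    avoids [v], as it would otherwise contain [C], hence [V = U :\ v]. *)
Lemma circuit_of_near_indep U u C : u \in U -> indep M (U :\ u) ->
    circuit M C -> C \subset U ->
  C = [set v in U | indep M (U :\ v)].
Proof.
move=> uU hu circC sCU; have /andP[_ nC] := circuit_dependent circC.
apply/setP=> v; rewrite inE; apply/idP/andP => [vC|[vU hv]]; last first.
  apply: contraR nC => vC; apply: indep_subset hv.
  by rewrite subsetD1 sCU.
have vU := subsetP sCU v vC; split=> //.
have hCv := circuitD1_indep circC vC.
have le : (#|C :\ v| <= #|U :\ u|)%N.
  have := subset_leq_card sCU; rewrite (cardsD1 v C) (cardsD1 u U) vC uU.
  by rewrite !add1n ltnS.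
have [V [hV sCV sVU cV]] := indep_extend hCv hu le.
have {}sVU : V \subset U.
  apply: subset_trans sVU _; rewrite subUset subD1set andbT.
  exact: subset_trans (subD1set _ _) sCU.
have vV : v \notin V.
  apply: contra nC => vV; apply: indep_subset hV.
  by rewrite -(setD1K vC) subUset sub1set vV.
suff -> : U :\ v = V by [].
apply/esym/eqP; rewrite eqEcard subsetD1 sVU vV /= cV.
by have := cardsD1 u U; rewrite (cardsD1 v U) uU vU !add1n => -[->].
Qed.

(** Trades the circuit count for a condition on facets: under (UC1) the nonzero terms of
    [chi_boundary] come exactly from the [u] with [U :\ u] independent. *)
Lemma unidependentP U :
  reflect (dependent M U /\ exists2 u, u \in U & indep M (U :\ u))
          (unidependent M U).
Proof.
apply: (iffP andP) => [[sU /cards1P[C eC]]|[dU [u uU hu]]].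
  have : C \in [set C0 | circuit M C0 && (C0 \subset U)] by rewrite eC set11.
  rewrite inE => /andP[circC sCU]; have dC := circuit_dependent circC.
  split; first exact: dependent_sup sCU dC.
  have /set0Pn[u uC] := circuit_neq0 circC.
  exists u; first exact: (subsetP sCU).
  apply/idPn => nI; have [|C' circC'] := @dependent_circuit (U :\ u).
    by rewrite dependentPn // (subset_trans (subD1set _ _)).
  rewrite subsetD1 => /andP[sC' uC'].
  have : C' \in [set C0 | circuit M C0 && (C0 \subset U)] by rewrite inE circC'.
  by rewrite eC inE => /eqP eC'; rewrite eC' uC in uC'.
have [sU _] := andP dU; split=> //; have [C circC sCU] := dependent_circuit dU.
apply/cards1P; exists C; apply/setP=> C'; rewrite !inE.
apply/andP/eqP => [[circC' sC']|->//].
by rewrite (circuit_of_near_indep uU hu circC') // (circuit_of_near_indep uU hu circC).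
Qed.

Lemma circuit_unidependent C : circuit M C -> unidependent M C.
Proof.
move=> circC; apply/unidependentP; split; first exact: circuit_dependent.
by have /set0Pn[u uC] := circuit_neq0 circC; exists u; rewrite ?circuitD1_indep.
Qed.

Lemma loopless_circuit_card C :
  (forall x, ~~ loop M x) -> circuit M C -> (1 < #|C|)%N.
Proof.
move=> noloop circC; have := circuit_neq0 circC; rewrite -card_gt0.
case E: #|C| => [|[|m]] // _; have /eqP/cards1P[y eC] := E.
by have := noloop y; rewrite /loop -eC circC.
Qed.

Lemma simple_indep2 x y : simple_matroid M -> x \in ground M -> y \in ground M ->
  indep M [set x; y].
Proof.
move=> [noloop nopar] xM yM; apply/idPn => nI.
have [|C circC sC] := @dependent_circuit [set x; y].
  by rewrite dependentPn // subUset !sub1set xM.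
have C1 := loopless_circuit_card noloop circC.
have eC : C = [set x; y].
  apply/eqP; rewrite eqEcard sC (leq_trans _ C1) // cards2.
  by case: (x != y).
have nexy : x != y by move: C1; rewrite eC cards2; case: (x != y).
by have := nopar x y; rewrite /parallel nexy -eC circC.
Qed.

(** This is the matroid closure when [I] is independent; for any other [I] it is the whole ground
    set. *)
Definition mclosure I := [set y in ground M | (y \in I) || ~~ indep M (y |: I)].

(** [S] is not confined to the ground set, so [setT] is flat in this sense; [flag_cone] relies on
    it. *)
Definition flat S := forall I y, indep M I -> I \subset S -> y \in ground M ->
  y \notin S -> indep M (y |: I).

Lemma mclosure_indep_card I J : indep M I -> indep M J -> J \subset mclosure I ->
  (#|J| <= #|I|)%N.
Proof.
move=> hI hJ sJ; rewrite leqNgt; apply/negP => ltIJ.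
have [y /setDP[yJ yI] hy] := indep_augment hI hJ ltIJ.
by have := subsetP sJ y yJ; rewrite inE (negPf yI) hy andbF.
Qed.

(** Extend [S] by elements of [y |: I] to an independent set with [#|I| + 1] elements. It must use
    [y], for otherwise it would lie in the closure of [I] and be too large. *)
Lemma mclosure_flat I : indep M I -> flat (mclosure I).
Proof.
move=> hI S y hS sS yM; rewrite inE yM /= negb_or negbK => /andP[yI hy].
have le : (#|S| <= #|y |: I|)%N.
  by rewrite cardsU1 yI (leq_trans (mclosure_indep_card hI hS sS)) ?leqnSn.
have [V [hV sSV sVS cV]] := indep_extend hS hy le.
have [yV|yV] := boolP (y \in V).
  by apply: indep_subset hV; rewrite subUset sub1set yV.
have sVI : V \subset mclosure I.
  apply/subsetP=> z zV; have := subsetP sVS z zV.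
  rewrite in_setU => /orP[/(subsetP sS)//|]; rewrite in_setU1 => /predU1P[ezy|zI].
    by rewrite ezy (negPf yV) in zV.
  by rewrite inE zI (subsetP (indep_ground hI)).
by have := mclosure_indep_card hI hV sVI; rewrite cV cardsU1 yI ltnn.
Qed.

Lemma mclosureS I J : I \subset J -> mclosure I \subset mclosure J.
Proof.
move=> sIJ; apply/subsetP=> y; rewrite !inE => /andP[-> /orP[/(subsetP sIJ)->//|nI]].
apply/orP; right; apply: contra nI; apply: indep_subset; exact: setUS.
Qed.

Lemma mclosure0 : (forall x, ~~ loop M x) -> mclosure set0 = set0.
Proof.
move=> noloop; apply/setP=> y; rewrite !inE setU0 /=.
apply/negP=> /andP[yM nI]; have [|C circC sC] := @dependent_circuit [set y].
  by rewrite dependentPn // sub1set.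
have := subset_leq_card sC; rewrite cards1 leqNgt.
by rewrite loopless_circuit_card.
Qed.

End MatroidFacts.

(** * Determinants of flags *)

Section FlagDeterminants.
Variables (n : nat) (K : fieldType) (x0 : 'I_n).
Implicit Types (F : nat -> {set 'I_n}) (I J U : {set 'I_n}) (M : matroid 'I_n).

Lemma enumD1 (T : finType) (A : {set T}) (u : T) :
  enum (A :\ u) = rem u (enum A).
Proof.
rewrite rem_filter ?enum_uniq // /enum_mem -filter_predI.
by apply: eq_filter => v; rewrite /= !inE.
Qed.

(** [bump p] is also the index shift of a matrix minor omitting column [p], which is how this
    identity enters the Laplace expansion. *)
Lemma nth_enumD1 U (p b : nat) : (p < #|U|)%N ->
  nth x0 (enum (U :\ nth x0 (enum U) p)) b = nth x0 (enum U) (bump p b).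
Proof.
move=> ltp; have lt' : (p < size (enum U))%N by rewrite -cardE.
rewrite enumD1 remE index_uniq ?enum_uniq // nth_cat size_take lt' /bump.
case: ltnP => [ltb|leb]; first by rewrite nth_take.
by rewrite nth_drop addSn subnKC.
Qed.

(** The default [x0] is read only when [#|J| < k]; the linear forms below restrict to [#|J| = k]. *)
Definition flag_mx k F J : 'M[K]_k :=
  \matrix_(a < k, b < k) (nth x0 (enum J) b \in F a)%:R.

Definition flag_det k F J : K := \det (flag_mx k F J).

(** Subtracting from each row the next one turns row [a] into the indicator of [F a :\: F a.+1]
    without changing the determinant. A nonzero term of the Leibniz formula is then the desired
    permutation. *)
Lemma flag_det_perm k F J : (forall a, F a.+1 \subset F a) -> F k = set0 ->
    flag_det k F J != 0 ->
  exists s : 'S_k, forall a : 'I_k, nth x0 (enum J) (s a) \in F a :\: F a.+1.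
Proof.
move=> nestF Fk0 nz.
(* Left multiplication by this unitriangular matrix takes differences of consecutive rows. *)
pose L : 'M[K]_k := \matrix_(a, b) ((a == b)%:R - (a.+1 == b)%:R).
have detL : \det L = 1.
  rewrite -det_tr det_trig.
    apply: big1 => i _; rewrite !mxE eqxx.
    by rewrite (gtn_eqF (ltnSn i)) subr0.
  apply/is_trig_mxP=> i j ltij; rewrite !mxE (gtn_eqF (leqW ltij)).
  have -> : (j == i) = false by apply/eqP=> e; rewrite e ltnn in ltij.
  by rewrite subr0.
have LB a b : (L *m flag_mx k F J) a b
            = (nth x0 (enum J) b \in F a :\: F a.+1)%:R.
  rewrite mxE (eq_bigr (fun j => (a == j)%:R * flag_mx k F J j b
                 - (a.+1 == j)%:R * flag_mx k F J j b)); last first.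
    by move=> j _; rewrite mxE mulrBl.
  rewrite sumrB (bigD1 a) //= big1 ?addr0 => [|j ne]; last first.
    by rewrite eq_sym (negPf ne) mul0r.
  rewrite eqxx mul1r mxE; set f := nth _ _ _.
  have -> : \sum_(j < k) (a.+1 == j)%:R * flag_mx k F J j b = (f \in F a.+1)%:R.
    have [lta|gea] := ltnP a.+1 k.
      rewrite (bigD1 (Ordinal lta)) //= big1 ?addr0 => [|j ne].
        by rewrite eqxx mul1r mxE.
      rewrite (_ : (a.+1 == j) = false) ?mul0r //.
      by apply/eqP=> e; case/eqP: ne; apply: val_inj.
    (* The last row has no successor; [F k = set0] plays the part of a zero row. *)
    have ek : a.+1 = k by apply/eqP; rewrite eqn_leq gea ltn_ord.
    rewrite ek Fk0 inE big1 // => j _.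
    by rewrite (gtn_eqF (ltn_ord j)) mul0r.
  rewrite inE; have := subsetP (nestF a) f.
  case: (f \in F a.+1) => /=; first by move=> ->; rewrite ?subrr.
  by rewrite subr0.
have : \det (L *m flag_mx k F J) != 0 by rewrite det_mulmx detL mul1r.
rewrite /determinant => nz'.
have [s _ nzs] : exists2 s : 'S_k, true &
    (-1) ^+ s * \prod_i (L *m flag_mx k F J) i (s i) != 0.
  apply/exists_inP; apply: contraNT nz' => /exists_inPn z.
  by rewrite big1 // => s _; apply/eqP; have := z s isT; rewrite negbK.
exists s => a; move: nzs; rewrite mulf_eq0 negb_or => /andP[_].
rewrite (bigD1 a) //= mulf_eq0 negb_or LB => /andP[].
by case: (_ \in _); rewrite // eqxx.
Qed.

(** The permutation lists [J] with one element in each layer [F a :\: F a.+1]. Starting from the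
    innermost layer, each new element lies outside a flat containing the earlier ones, so
    independence persists. *)
Lemma flag_det_indep M k F J : (forall a, F a.+1 \subset F a) -> F k = set0 ->
    (forall a, flat M (F a)) -> J \subset ground M -> #|J| = k ->
  flag_det k F J != 0 -> indep M J.
Proof.
move=> nestF Fk0 flatF sJ cJ /(flag_det_perm nestF Fk0)[s sP].
pose g (a : 'I_k) := nth x0 (enum J) (s a).
have gJ a : g a \in J by rewrite -mem_enum mem_nth // -cardE cJ.
pose S m := [set g a | a : 'I_k & (m <= a)%N].
(* Induction downwards from index [k]: [S (k - m)] collects the elements of the [m] innermost
   layers. *)
have claim m : (m <= k)%N -> indep M (S (k - m)%N) /\ S (k - m)%N \subset F (k - m)%N.
  elim: m => [|m IH] ltm.
    have -> : S (k - 0)%N = set0.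
      apply/setP=> y; rewrite inE; apply/imsetP=> -[a]; rewrite inE subn0 leqNgt.
      by rewrite ltn_ord.
    by rewrite indep_set0 sub0set.
  have [hS sS] := IH (ltnW ltm).
  have ea : (k - m)%N = (k - m.+1).+1 by rewrite subnSK.
  have lta : (k - m.+1 < k)%N by rewrite -ea leq_subr.
  have -> : S (k - m.+1)%N = g (Ordinal lta) |: S (k - m)%N.
    apply/setP=> y; rewrite in_setU1; apply/imsetP/predU1P.
      case=> a; rewrite inE leq_eqVlt => /predU1P[e|lt] ->.
        by left; congr g; apply: val_inj.
      by right; apply/imsetP; exists a; rewrite // inE ea.
    case=> [->|/imsetP[a]]; first by exists (Ordinal lta); rewrite ?inE.
    by rewrite inE ea => /ltnW lt ->; exists a; rewrite ?inE.
  have /setDP[gF gF'] := sP (Ordinal lta).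
  split.
    apply: (flatF (k - m)%N) => //; first exact: (subsetP sJ).
    by rewrite ea.
  rewrite subUset sub1set gF (subset_trans sS) //= ea; exact: nestF.
have [] := claim k (leqnn k); rewrite subnn => hS _.
apply: indep_subset hS; apply/subsetP=> y yJ.
have lt : (index y (enum J) < k)%N by rewrite -cJ cardE index_mem mem_enum.
apply/imsetP; exists (s^-1%g (Ordinal lt)); rewrite ?inE //.
by rewrite /g permKV nth_index ?mem_enum.
Qed.

(** Putting [setT] in front adds a top row of ones to the flag matrix. *)
Definition flag_cone F a := if a is a'.+1 then F a' else setT.

(** Laplace expansion along the row of ones: the minor omitting column [p] is the flag matrix of [U]
    without its element at position [p]. *)
Lemma flag_det_boundary k F U : #|U| = k.+1 ->
  \sum_(p < #|U|) (-1) ^+ p * flag_det k F (U :\ enum_val p)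
    = flag_det k.+1 (flag_cone F) U.
Proof.
move=> cU; rewrite (eq_bigr (fun p : 'I_#|U| =>
    (-1) ^+ p * flag_det k F (U :\ nth x0 (enum U) p))); last first.
  by move=> p _; rewrite (enum_val_nth x0).
transitivity (\sum_(p < k.+1) (-1) ^+ p * flag_det k F (U :\ nth x0 (enum U) p)).
  by rewrite cU.
rewrite [RHS](expand_det_row _ ord0); apply: eq_bigr => p _.
rewrite mxE inE mul1r /cofactor add0n; congr (_ * \det _).
apply/matrixP=> a b; rewrite !mxE nth_enumD1 ?cU //.
Qed.

End FlagDeterminants.

(** * The ideal of a chi-algebra *)

Section Monomials.
Variables (n : nat) (K : fieldType) (beta : 'I_n -> 'I_n -> K).
Local Notation E := (qext beta).
Implicit Types (X Y Z S : {set 'I_n}).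

Lemma qmonME X Y : qmon beta X * qmon beta Y =
  if [disjoint X & Y] then qtwist beta X Y *: qmon beta (X :|: Y) else 0.
Proof. exact: qmul_mon. Qed.

Lemma qmon_self X : qmon beta X X = 1.
Proof. by rewrite ffunE eqxx. Qed.

Section LinearExtension.
Variables (W : lmodType K) (g : {set 'I_n} -> W).

Definition qmon_ext (a : E) : W := \sum_X (a X : K) *: g X.

Fact qmon_ext_is_linear : linear qmon_ext.
Proof.
move=> k a b; rewrite /qmon_ext scaler_sumr -big_split; apply: eq_bigr => X _ /=.
by rewrite !ffunE scalerDl scalerA.
Qed.
HB.instance Definition _ := GRing.isLinear.Build K E W _ qmon_ext qmon_ext_is_linear.

Lemma qmon_ext_mon X : qmon_ext (qmon beta X) = g X.
Proof.
rewrite /qmon_ext (bigD1 X) //= big1 ?addr0 => [|Y neYX].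
  by rewrite qmon_self scale1r.
by rewrite ffunE (negPf neYX) scale0r.
Qed.

End LinearExtension.

Lemma linear_qmon (W : lmodType K) (f : {linear E -> W}) a :
  f a = \sum_X (a X : K) *: f (qmon beta X).
Proof.
by rewrite {1}(qmon_expand a) linear_sum; apply: eq_bigr => X _; rewrite linearZ.
Qed.

Hypothesis beta_neq0 : forall i j : 'I_n, (i < j)%N -> beta i j != 0.

Lemma qtwist_neq0 X Y : qtwist beta X Y != 0.
Proof.
apply/prodf_neq0 => j _; apply/prodf_neq0 => i /andP[_]; exact: beta_neq0.
Qed.

End Monomials.

Section Subalgebra.
Variables (n : nat) (K : fieldType) (beta : 'I_n -> 'I_n -> K).
Local Notation E := (qext beta).
Implicit Types (X Y Z S : {set 'I_n}).

Lemma qmon_spanP (P : pred {set 'I_n}) (v : E) :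
  reflect (forall X, ~~ P X -> v X = 0)
          (v \in <<[seq qmon beta X | X : {set 'I_n} in P]>>%VS).
Proof.
apply: (iffP idP) => [/coord_span-> X nPX|vP].
  rewrite sum_ffunE big1 // => i _; set s := image_tuple _ _.
  have /imageP[Y PY ->] : s`_i \in [seq qmon beta X | X : {set 'I_n} in P].
    by apply: mem_nth; rewrite size_tuple.
  rewrite !ffunE; case: eqP => [eXY|_]; last exact: mulr0.
  by rewrite -topredE /= -eXY (negPf nPX) in PY.
rewrite (qmon_expand v); apply: rpred_sum => X _.
have [PX|nPX] := boolP (P X); last by rewrite vP // scale0r mem0v.
by apply/memvZ/memv_span/imageP; exists X.
Qed.

Lemma qmon_gen_subalg X S : X \subset S -> qmon beta X \in gen_subalg beta S.
Proof.
move=> sXS; rewrite -qprodE /qprod.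
apply: (big_ind (fun a : E => a \in gen_subalg beta S)) => [|a b|i iX].
- by rewrite memvE sub1_agenv.
- exact: memvM.
apply: (subvP (sub_agenv _)); apply: memv_span; apply: image_f.
exact: (subsetP sXS).
Qed.

Lemma gen_subalgE S : (gen_subalg beta S : {vspace E}) =
  <<[seq qmon beta X | X : {set 'I_n} in [pred X : {set 'I_n} | X \subset S]]>>%VS.
Proof.
apply/eqP; rewrite eqEsubv; apply/andP; split; last first.
  apply/span_subvP=> v /imageP[X]; rewrite inE => sXS ->.
  exact: qmon_gen_subalg.
(* It suffices that the span contains 1 and is stable under left multiplication by the
   generators. *)
apply: agenv_sub_modl.
  rewrite -memvE; apply: memv_span; apply/imageP; exists set0 => //.
  by rewrite inE sub0set.
apply/prodvP=> u v /coord_span-> /coord_span->.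
  rewrite mulr_suml; apply: rpred_sum => i _; rewrite mulr_sumr.
  apply: rpred_sum => j _; rewrite -scalerAl -scalerAr !memvZ //.
  set s1 := image_tuple _ _; set s2 := image_tuple _ _.
  have /imageP[a aS ->] : s1`_i \in [seq qgen beta i | i in S].
    by apply: mem_nth; rewrite size_tuple.
  have /imageP[X] : s2`_j \in [seq qmon beta X | X : {set 'I_n} in [pred X : {set 'I_n} | X \subset S]].
    by apply: mem_nth; rewrite size_tuple.
  rewrite inE => sXS ->; rewrite /qgen qmonME; case: ifP => _; last exact: mem0v.
  apply/memvZ/memv_span/imageP; exists ([set a] :|: X) => //.
  by rewrite inE subUset sub1set aS.
Qed.

Lemma gen_subalgP S (v : E) :
  reflect (forall X, ~~ (X \subset S) -> v X = 0) (v \in gen_subalg beta S).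
Proof.
rewrite -[_ \in _]/(v \in (gen_subalg beta S : {vspace E})) gen_subalgE.
exact: qmon_spanP.
Qed.

Lemma gen_subalg_ind S (W : {vspace E}) (f : {linear E -> E}) :
  (forall X, X \subset S -> f (qmon beta X) \in W) ->
  forall v, v \in gen_subalg beta S -> f v \in W.
Proof.
move=> fW v /gen_subalgP vS; rewrite linear_qmon; apply: rpred_sum => X _.
have [sXS|nXS] := boolP (X \subset S); first by rewrite memvZ // fW.
by rewrite vS // scale0r mem0v.
Qed.

End Subalgebra.

Section Boundary.
Variables (n : nat) (K : fieldType) (beta : 'I_n -> 'I_n -> K).
Implicit Types (X U : {set 'I_n}) (chi : {set 'I_n} -> K).

(** Indexing by elements instead of positions lets single facets be split off; the successor is
    there because [index] counts from 0. *)
Definition boundary_coef chi X i : K :=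
  (-1) ^+ (index i (enum X)).+1 * chi (X :\ i).

Lemma chi_boundaryE chi X : chi_boundary beta chi X =
  \sum_(i in X) boundary_coef chi X i *: qmon beta (X :\ i).
Proof.
rewrite /chi_boundary [RHS]big_enum_val; apply: eq_bigr => p _; rewrite qprodE.
rewrite /boundary_coef; congr ((-1) ^+ _.+1 * _ *: _).
by rewrite [in RHS](enum_val_nth (enum_val p)) index_uniq ?enum_uniq -?cardE.
Qed.

End Boundary.

Section RelationSpace.
Variables (n : nat) (K : fieldType) (beta : 'I_n -> 'I_n -> K).
Local Notation E := (qext beta).
Variables (M : matroid 'I_n) (chi : {set 'I_n} -> K).
Implicit Types (X Y Z S D U C : {set 'I_n}).

Definition rel_space : {vspace E} :=
  << [seq qmon beta D | D : {set 'I_n} in dependent M]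
     ++ [seq chi_boundary beta chi U | U : {set 'I_n} in dependent M] >>%VS.

Lemma rel_space_mon D : dependent M D -> qmon beta D \in rel_space.
Proof.
move=> dD; apply: memv_span; rewrite mem_cat; apply/orP; left.
by apply/imageP; exists D.
Qed.

Lemma rel_space_boundary U : dependent M U -> chi_boundary beta chi U \in rel_space.
Proof.
move=> dU; apply: memv_span; rewrite mem_cat; apply/orP; right.
by apply/imageP; exists U.
Qed.

Lemma rel_space_sub (W : {vspace E}) :
    (forall D, dependent M D -> qmon beta D \in W) ->
    (forall U, dependent M U -> chi_boundary beta chi U \in W) ->
  (rel_space <= W)%VS.
Proof.
move=> hD hU; apply/span_subvP=> v; rewrite mem_cat => /orP[] /imageP[X dX ->].
  exact: hD.
exact: hU.
Qed.

Lemma rel_space_map (V : vectType K) (W : {vspace V}) (f : {linear E -> V}) :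
    (forall D, dependent M D -> f (qmon beta D) \in W) ->
    (forall U, dependent M U -> f (chi_boundary beta chi U) \in W) ->
  forall v, v \in rel_space -> f v \in W.
Proof.
move=> hD hU v vR; rewrite -[f v](lfunE f).
rewrite memv_preim; apply: subvP vR; apply: rel_space_sub => X dX.
  by rewrite -memv_preim lfunE hD.
by rewrite -memv_preim lfunE hU.
Qed.

Lemma rel_space_subalg : (rel_space <= gen_subalg beta (ground M))%VS.
Proof.
apply: rel_space_sub => [D /andP[sD _]|U /andP[sU _]].
  exact: qmon_gen_subalg.
rewrite chi_boundaryE; apply: rpred_sum => i _; rewrite memvZ // qmon_gen_subalg //.
exact: subset_trans (subD1set _ _) sU.
Qed.

Hypothesis beta_neq0 : forall i j : 'I_n, (i < j)%N -> beta i j != 0.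
Hypothesis noloop : forall i, ~~ loop M i.
Hypothesis chiM : is_chi_algebra beta M chi.

Lemma chi_dep_eq0 D : dependent M D -> chi D = 0.
Proof.
case/andP=> sD nD; apply/eqP/idPn => nz.
by case: chiM => /(_ D sD)[/(_ nz)]; rewrite (negPf nD).
Qed.

Lemma chi_indep_neq0 I : indep M I -> chi I != 0.
Proof. by move=> hI; case: chiM => /(_ I (indep_ground hI))[_ ->]. Qed.

(* All facets of a set containing two circuits are dependent. *)
Lemma boundary_dep U : dependent M U ->
  unidependent M U \/ chi_boundary beta chi U = 0.
Proof.
move=> dU; have [uU|nU] := boolP (unidependent M U); [by left | right].
rewrite chi_boundaryE big1 // => i iU; rewrite /boundary_coef chi_dep_eq0 ?mulr0 ?scale0r //.
have /andP[sU _] := dU.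
rewrite dependentPn ?(subset_trans (subD1set _ _)) //.
apply: contra nU => hi; apply/unidependentP; split=> //.
by exists i.
Qed.

Lemma ideal_gen_boundary C : circuit M C ->
  chi_boundary beta chi C \in <<chi_ideal_gens beta M chi>>%VS.
Proof.
move=> circC; apply: memv_span; rewrite mem_cat; apply/orP; left.
by apply/imageP; exists C; rewrite // inE circC (loopless_circuit_card noloop).
Qed.

Lemma ideal_boundaryM C Y : circuit M C -> Y \subset ground M ->
  chi_boundary beta chi C * qmon beta Y \in chi_ideal beta M chi.
Proof.
by move=> circC sY; rewrite memv_mul ?ideal_gen_boundary ?qmon_gen_subalg.
Qed.

(** If [C] and [Y] are disjoint with unidependent union, (UC2) makes the product a multiple of the
    boundary of the union. Otherwise every surviving term is a dependent monomial: it contains [C]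
    when [i] is in [Y], and else it is a facet of a dependent set that is not unidependent. *)
Lemma boundary_circuitM C Y : circuit M C -> Y \subset ground M ->
  chi_boundary beta chi C * qmon beta Y \in rel_space.
Proof.
move=> circC sY; have dC := circuit_dependent circC; have /andP[sC _] := dC.
have sU : C :|: Y \subset ground M by rewrite subUset sC.
have dU : dependent M (C :|: Y) by apply: dependent_sup dC; rewrite ?subsetUl.
case: (boolP ([disjoint C & Y] && unidependent M (C :|: Y))) => [/andP[dis uU]|nU].
  case: chiM => _ /(_ _ _ uU (circuit_unidependent circC) (subsetUl _ _))[e e0].
  have -> : (C :|: Y) :\: C = Y.
    rewrite setDUl setDv set0U; apply/setDidPl; by rewrite disjoint_sym.
  rewrite qprodE => eU; rewrite -(scalerK e0 (_ * _)) -eU memvZ //.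
  exact: rel_space_boundary.
rewrite chi_boundaryE mulr_suml; apply: rpred_sum => i iC.
rewrite -scalerAl memvZ // qmonME; case: ifP => dis; last exact: mem0v.
apply/memvZ/rel_space_mon.
have [iY|iY] := boolP (i \in Y).
  apply: dependent_sup dC; first by rewrite subUset (subset_trans (subD1set _ _)).
  by rewrite -{1}(setD1K iC) subUset subsetUl sub1set inE iY orbT.
have eU : C :\ i :|: Y = (C :|: Y) :\ i.
  by apply/setP=> j; rewrite !inE; case: eqP => // ->; rewrite (negPf iY).
rewrite eU dependentPn ?(subset_trans (subD1set _ _)) //.
apply: contra nU => hi; apply/andP; split; last first.
  by apply/unidependentP; split=> //; exists i; rewrite // inE iC.
by rewrite -(setD1K iC) disjUl dis disjoints1 iY.
Qed.

Lemma chi_idealE : chi_ideal beta M chi = rel_space.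
Proof.
apply/eqP; rewrite eqEsubv; apply/andP; split.
  apply/prodvP=> u v /coord_span->.
  rewrite [v]qmon_expand => /gen_subalgP vG; rewrite mulr_suml; apply: rpred_sum => i _.
  rewrite mulr_sumr; apply: rpred_sum => Y _; rewrite -scalerAl -scalerAr.
  apply: memvZ.
  have [sY|nY] := boolP (Y \subset ground M); last first.
    by have := vG Y nY; rewrite -qmon_expand => ->; rewrite scale0r mem0v.
  apply: memvZ; set g := _`_i.
  have : g \in chi_ideal_gens beta M chi by apply: mem_nth; rewrite size_tuple.
  rewrite mem_cat => /orP[/imageP[C]|/imageP[j]]; last first.
    by rewrite -topredE /= (negPf (noloop j)).
  by rewrite inE => /andP[circC _] ->; apply: boundary_circuitM.
apply: rel_space_sub => [D dD|U dU].
  have [C circC sCD] := dependent_circuit dD; have /andP[sD _] := dD.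
  have /set0Pn[i iC] := circuit_neq0 circC.
  have dis : [disjoint [set i] & D :\: C] by rewrite disjoints1 inE iC.
  (* Right multiplication by this monomial kills every term of the boundary of [C] still containing
     [i]; the one left is a nonzero multiple of the monomial of [D]. *)
  have := ideal_boundaryM circC (Y := i |: (D :\: C)).
  rewrite subUset sub1set (subsetP sD) ?(subsetP sCD) //=.
  rewrite (subset_trans (subsetDl _ _)) // => /(_ isT).
  rewrite chi_boundaryE mulr_suml (bigD1 i) //= big1 ?addr0 => [|j /andP[jC ne]].
    rewrite -scalerAl qmonME disjUr disjoint_sym disjoints1 !inE eqxx /=.
    have -> : [disjoint C :\ i & D :\: C].
      rewrite disjoints_subset; apply/subsetP=> j; rewrite !inE => /andP[_ ->].
      by [].
    have -> : C :\ i :|: (i |: D :\: C) = D.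
      rewrite setUCA setUA setD1K // -{2}(setID D C); congr (_ :|: _).
      exact/esym/setIidPr.
    rewrite scalerA => h; rewrite -[qmon beta D]scale1r.
    set k := (X in X *: _ \in _) in h.
    have k0 : k != 0.
      rewrite mulf_neq0 ?qtwist_neq0 // /boundary_coef mulf_neq0 ?signr_eq0 //.
      by rewrite chi_indep_neq0 // circuitD1_indep.
    by rewrite -(mulVf k0) -scalerA memvZ.
  rewrite -scalerAl qmonME disjUr disjoint_sym disjoints1 !inE iC andbT.
  by rewrite eq_sym ne /= scaler0.
have [uU|->] := boundary_dep dU; last exact: mem0v.
have /andP[sU _] := dU; have [C circC sCU] := dependent_circuit dU.
case: chiM => _ /(_ _ _ uU (circuit_unidependent circC) sCU)[e e0 ->].
rewrite qprodE memvZ // ideal_boundaryM // (subset_trans (subsetDl _ _)) //.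
Qed.

End RelationSpace.

(** * Deletion and contraction *)

Section Signs.
Variables (n : nat) (K : fieldType).
Implicit Types (X U : {set 'I_n}) (chi : {set 'I_n} -> K) (x i : 'I_n).

Lemma count_enum X (P : pred 'I_n) : count P (enum X) = (\sum_(j in X) P j)%N.
Proof. by rewrite -sum1_count big_mkcond /= big_enum. Qed.

Lemma index_enum_sum X i : i \in X -> index i (enum X) = (\sum_(j in X) (j < i))%N.
Proof.
rewrite -mem_enum -(count_enum X (fun j => j < i)%N).
elim: (enum X) (sorted_enum_set X) => //= a s IH pas; rewrite inE.
have /andP[/allP lts sts] : all (ltn a) (map val s) && sorted ltn (map val s).
  by rewrite (order_path_min ltn_trans pas) (path_sorted pas).
have {}lts j : j \in s -> (a < j)%N by move=> js; apply: lts; apply: map_f.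
rewrite (eq_sym a); case: eqP => [-> _|ne /= ins].
  rewrite ltnn add0n; apply/esym/eqP; rewrite -leqn0 leqNgt -has_count.
  by apply/hasPn=> j /lts/ltnW; rewrite leqNgt.
by rewrite lts // IH.
Qed.

Lemma inversions_sorted (s : seq 'I_n) : sorted ltn (map val s) -> inversions s = 0%N.
Proof.
elim: s => //= a s IH pas; rewrite IH ?(path_sorted pas) // addn0.
apply/eqP; rewrite -leqn0 leqNgt -has_count; apply/hasPn=> j js.
have /allP/(_ (val j)) := order_path_min ltn_trans pas.
by rewrite -leqNgt => h; apply/ltnW/h/map_f.
Qed.

Lemma inversions_rcons (s : seq 'I_n) x :
  inversions (rcons s x) = (inversions s + count (fun j : 'I_n => x < j)%N s)%N.
Proof.
elim: s => //= a s ->; rewrite -cats1 count_cat /= addn0.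
exact: addnACA.
Qed.

(** The number of transpositions that bring [x] from the end of the listing [U * x] to its sorted
    position. *)
Definition num_above x U := (\sum_(j in U) (x < j))%N.

Lemma contr_chiE chi x U :
  contr_chi chi x U = (-1) ^+ num_above x U * chi (x |: U).
Proof.
rewrite /contr_chi /chi_rcons /chi_list inversions_rcons.
rewrite inversions_sorted ?sorted_enum_set // count_enum; congr (_ * chi _).
by apply/setP=> j; rewrite !inE mem_rcons inE mem_enum.
Qed.

(** Inserting [x] shifts the position of [i] by 1 exactly when [x < i], and removing [i] from [U]
    lowers [num_above] by 1 in the same case; the parities agree. *)
Lemma boundary_coef_contr chi x U i : x \notin U -> i \in U ->
  boundary_coef chi (x |: U) i =
    (-1) ^+ num_above x U * boundary_coef (contr_chi chi x) U i.
Proof.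
move=> xU iU; rewrite /boundary_coef contr_chiE.
have xi : x != i by apply: contraNneq xU => ->.
have -> : x |: (U :\ i) = (x |: U) :\ i.
  by apply/setP=> j; rewrite !inE; case: eqP => //= ->; rewrite xi.
rewrite !index_enum_sum ?setU1r // big_setU1 //=.
rewrite /num_above [(\sum_(j in U) (x < j))%N](big_setD1 i iU) /=.
rewrite !mulrA -!exprD; congr (_ * _); rewrite -[LHS]signr_odd -[RHS]signr_odd.
congr (_ ^+ (nat_of_bool _)); rewrite !(oddD, oddS).
set A := odd (\sum_(j in U) _)%N; set B := odd (\sum_(j in _ :\ _) _)%N.
by case: A; case: B; case: (x < i)%N.
Qed.

End Signs.

Section Minors.
Variables (n : nat) (K : fieldType) (beta : 'I_n -> 'I_n -> K).
Local Notation E := (qext beta).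
Variables (M : matroid 'I_n) (chi : {set 'I_n} -> K) (x : 'I_n).
Implicit Types (X Y Z S D U C : {set 'I_n}).

Lemma deletion_dependent U :
  dependent (deletion M x) U = (x \notin U) && dependent M U.
Proof.
rewrite /dependent /= /del_indep subsetD1; case: (x \in U) => /=.
  by rewrite andbF.
by rewrite andbT.
Qed.

Lemma deletion_circuit C :
  circuit (deletion M x) C = (x \notin C) && circuit M C.
Proof.
apply/minsetP/andP => [[]|[xC /minsetP[dC minC]]].
  rewrite deletion_dependent => /andP[xC dC] minC; split=> //.
  apply/minsetP; split=> // B dB sBC; apply: minC => //.
  by rewrite deletion_dependent dB andbT; apply: contra xC; apply: (subsetP sBC).
split; first by rewrite deletion_dependent xC.
by move=> B; rewrite deletion_dependent => /andP[_ dB]; apply: minC.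
Qed.

Lemma deletion_loopless :
  (forall i, ~~ loop M i) -> forall i, ~~ loop (deletion M x) i.
Proof. by move=> noloop i; rewrite /loop deletion_circuit negb_and noloop orbT. Qed.

Lemma deletion_unidependent U :
  unidependent (deletion M x) U -> unidependent M U.
Proof.
case/unidependentP=> dU [u uU /andP[_ hu]]; apply/unidependentP; split.
  by move: dU; rewrite deletion_dependent => /andP[].
by exists u.
Qed.

Lemma deletion_chi_algebra :
  is_chi_algebra beta M chi -> is_chi_algebra beta (deletion M x) chi.
Proof.
case=> uc1 uc2; split=> [I|U U' uU uU' sU].
  rewrite /= subsetD1 => /andP[sI xI]; rewrite /del_indep xI; exact: uc1.
by apply: uc2 => //; apply: deletion_unidependent.
Qed.

Definition residue : {linear E -> E} :=
  qmon_ext (fun X => if x \in X then qmon beta (X :\ x) else 0).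

(** A linear right inverse of [residue] on monomials avoiding [x]; it will provide the splitting. *)
Definition coresidue : {linear E -> E} :=
  qmon_ext (fun X => if x \in X then 0 else qmon beta (x |: X)).

Lemma residue_mon X :
  residue (qmon beta X) = if x \in X then qmon beta (X :\ x) else 0.
Proof. exact: qmon_ext_mon. Qed.

Lemma coresidue_mon X :
  coresidue (qmon beta X) = if x \in X then 0 else qmon beta (x |: X).
Proof. exact: qmon_ext_mon. Qed.

Lemma residue_boundary U : x \notin U ->
  residue (chi_boundary beta chi (x |: U)) =
    (-1) ^+ num_above x U *: chi_boundary beta (contr_chi chi x) U.
Proof.
move=> xU; rewrite !chi_boundaryE linear_sum /= big_setU1 //= linearZ /=.
rewrite residue_mon !inE eqxx /= scaler0 add0r scaler_sumr.
apply: eq_bigr => i iU; rewrite linearZ /= residue_mon.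
have xi : x != i by apply: contraNneq xU => ->.
rewrite !inE xi eqxx /= scalerA boundary_coef_contr //; congr (_ *: qmon _ _).
apply/setP=> j; rewrite !inE; case: eqP => //= ->.
by rewrite (negPf xU) andbF.
Qed.

(** The facet that drops [x] is out of reach of [coresidue], hence the correction; that term belongs
    to the subalgebra of the deletion. *)
Lemma coresidue_boundary U : x \notin U ->
  coresidue (chi_boundary beta (contr_chi chi x) U) =
    (-1) ^+ num_above x U *: (chi_boundary beta chi (x |: U)
      - boundary_coef chi (x |: U) x *: qmon beta U).
Proof.
move=> xU; rewrite !chi_boundaryE big_setU1 //= setU1K // addrC addrK.
rewrite linear_sum /= scaler_sumr.
apply: eq_bigr => i iU; rewrite linearZ /= coresidue_mon !inE.
have xi : x != i by apply: contraNneq xU => ->.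
rewrite xi (negPf xU) /= scalerA boundary_coef_contr // mulrA -exprD.
rewrite -signr_odd addnn odd_double mul1r; congr (_ *: qmon _ _).
by apply/setP=> j; rewrite !inE; case: eqP => //= ->; rewrite xi.
Qed.

(** The twist of [X] against [Y] is multiplicative in [X], so the contribution of [x] is a scalar
    common to all monomials of [v]. *)
Lemma residueM v Y : x \notin Y ->
  residue (v * qmon beta Y) = qtwist beta [set x] Y *: (residue v * qmon beta Y).
Proof.
move=> xY; rewrite {1}[v]qmon_expand mulr_suml linear_sum /=.
rewrite (linear_qmon residue v) mulr_suml scaler_sumr; apply: eq_bigr => X _.
rewrite -!scalerAl linearZ /= scalerA mulrC -scalerA; congr (_ *: _).
rewrite residue_mon qmonME; case: ifPn => [dis|ndis].
  rewrite linearZ /= residue_mon inE (negPf xY) orbF.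
  case: ifP => xX; last by rewrite mul0r !scaler0.
  have [disx dis'] : [disjoint [set x] & Y] /\ [disjoint X :\ x & Y].
    by apply/andP; rewrite -disjUl setD1K.
  rewrite qmonME dis' scalerA -qtwistUl ?disjoints1 ?setD11 // setD1K //.
  congr (_ *: qmon _ _); apply/setP=> j; rewrite !inE; case: eqP => //= ->.
  by rewrite (negPf xY).
rewrite linear0; case: ifP => xX; last by rewrite mul0r scaler0.
rewrite qmonME ifN ?scaler0 //; apply: contra ndis => dis.
by rewrite -(setD1K xX) disjUl dis disjoints1 xY.
Qed.

Hypothesis beta_neq0 : forall i j : 'I_n, (i < j)%N -> beta i j != 0.
Hypothesis indx : indep M [set x].

Lemma contraction_dependent U :
  dependent (contraction M x) U = (x \notin U) && dependent M (x |: U).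
Proof.
rewrite /dependent /= /contr_indep indx subsetD1 subUset.
have -> : [set x] \subset ground M by apply: indep_ground indx.
by case: (x \in U) => /=; rewrite ?andbF ?andbT.
Qed.

Lemma contraction_unidependent U :
  unidependent (contraction M x) U -> unidependent M (x |: U).
Proof.
case/unidependentP; rewrite contraction_dependent => /andP[xU dU] [u uU].
rewrite /= /contr_indep indx => /andP[_ hu]; apply/unidependentP; split=> //.
exists u; first by rewrite setU1r.
suff <- : x |: (U :\ u) = (x |: U) :\ u by [].
have xu : x != u by apply: contraNneq xU => ->.
by apply/setP=> j; rewrite !inE; case: eqP => //= ->; rewrite xu.
Qed.

(** (UC2) for [x |: U'] inside [x |: U] becomes (UC2) for [U'] inside [U] after applying [residue],
    which respects boundaries and right multiplication up to nonzero scalars. *)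
Lemma contraction_chi_algebra : is_chi_algebra beta M chi ->
  is_chi_algebra beta (contraction M x) (contr_chi chi x).
Proof.
case=> uc1 uc2; split=> [I|U U' uU uU' sU].
  rewrite /= subsetD1 => /andP[sI xI]; rewrite /contr_indep xI indx.
  rewrite contr_chiE mulf_eq0 signr_eq0 /=; apply: uc1.
  by rewrite subUset sI andbT; apply: indep_ground indx.
have xU : x \notin U.
  by case/unidependentP: uU; rewrite contraction_dependent => /andP[].
have xU' : x \notin U' by apply: contra xU; apply: (subsetP sU).
have [||e e0 eq] := uc2 (x |: U) (x |: U') _ _ (setUS _ sU).
- exact: contraction_unidependent.
- exact: contraction_unidependent.
have eD : (x |: U) :\: (x |: U') = U :\: U'.
  apply/setP=> j; rewrite !inE; case: eqP => //= ->.
  by rewrite (negPf xU) andbF.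
have xD : x \notin U :\: U' by rewrite inE (negPf xU) andbF.
have := congr1 residue eq; rewrite eD qprodE residue_boundary // linearZ /= residueM //.
rewrite residue_boundary // -scalerAl !scalerA => /(congr1 ( *:%R ((-1) ^+ num_above x U))).
rewrite scalerA -exprD -signr_odd addnn odd_double scale1r => ->.
exists ((-1) ^+ num_above x U * (e * qtwist beta [set x] (U :\: U') * (-1) ^+ num_above x U')).
  by rewrite !mulf_neq0 ?signr_eq0 ?qtwist_neq0.
by rewrite scalerA.
Qed.

Lemma contraction_loopless : simple_matroid M -> forall i, ~~ loop (contraction M x) i.
Proof.
move=> simM i; apply/negP=> /circuit_dependent; rewrite contraction_dependent.
case/andP=> _ /andP[]; rewrite subUset !sub1set => /andP[xM iM].
by rewrite simple_indep2.
Qed.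

End Minors.

(** * Sets without broken circuits *)

(* [J] contains no broken circuit: no [c] outside [J] is spanned by the
   elements of [J] larger than [c]. *)
Definition nbc (n : nat) (M : matroid 'I_n) (J : {set 'I_n}) :=
  indep M J &&
  [forall c in ground M :\: J, indep M (c |: [set j in J | (c < j)%N])].

Section NbcSpan.
Variables (n : nat) (K : fieldType) (beta : 'I_n -> 'I_n -> K).
Local Notation E := (qext beta).
Variables (M : matroid 'I_n) (chi : {set 'I_n} -> K).
Hypothesis chiM : is_chi_algebra beta M chi.
Implicit Types (X J U : {set 'I_n}).

(** If [c] witnesses a broken circuit of an independent [J], the boundary of [c |: J] expresses the
    monomial of [J] through the other facets. Dropping [i < c] leaves a dependent set; dropping
    [i > c] replaces [i] by the smaller [c], so the sum of the elements decreases. *)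
Lemma nbc_span X : X \subset ground M -> qmon beta X \in
  (rel_space beta M chi + <<[seq qmon beta J | J : {set 'I_n} in nbc M]>>)%VS.
Proof.
set W := (_ + _)%VS; have [m] := ubnP (\sum_(i in X) i)%N.
elim: m X => // m IH J ltJ sJ.
have relW v : v \in rel_space beta M chi -> v \in W by apply: subvP; apply: addvSl.
have [hJ|nJ] := boolP (indep M J); last first.
  by apply/relW/rel_space_mon; rewrite dependentPn.
have [nbcJ|] := boolP (nbc M J).
  apply: subvP (addvSr _ _) _ _; apply: memv_span; apply/imageP; exists J => //.
rewrite /nbc hJ => /forall_inPn[c /setDP[cM cJ] nc].
have sU : c |: J \subset ground M by rewrite subUset sub1set cM.
have dc : dependent M (c |: [set j in J | (c < j)%N]).
  rewrite dependentPn //; apply: subset_trans sU; apply: setUS.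
  by apply/subsetP=> j; rewrite inE => /andP[].
have dU : dependent M (c |: J).
  apply: dependent_sup dc => //; apply: setUS.
  by apply/subsetP=> j; rewrite inE => /andP[].
have := relW _ (rel_space_boundary beta chi dU).
rewrite chi_boundaryE big_setU1 //= setU1K // => bW.
set k := boundary_coef _ _ _ in bW; have k0 : k != 0.
  rewrite /k /boundary_coef setU1K // mulf_neq0 ?signr_eq0 //.
  exact: (chi_indep_neq0 chiM).
rewrite -(scalerK k0 (qmon beta J)) memvZ //.
rewrite -(addrK (\sum_(i in J) boundary_coef chi (c |: J) i *: qmon beta ((c |: J) :\ i))
   (k *: _)) rpredB //.
apply: rpred_sum => i iJ; apply: memvZ.
have sUi : (c |: J) :\ i \subset ground M.
  by rewrite (subset_trans (subD1set _ _)).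
have [lti|gei] := ltnP c i; last first.
  apply/relW/rel_space_mon; apply: dependent_sup dc => //.
  have ci : c != i by apply: contraNneq cJ => ->.
  apply/subsetP=> j; rewrite !inE => /predU1P[->|/andP[-> ltj]].
    by rewrite eqxx andbT ci.
  by rewrite orbT andbT; apply: contraTneq ltj => ->; rewrite -leqNgt.
apply: IH => //; rewrite -ltnS; apply: leq_trans ltJ; rewrite ltnS.
rewrite (big_setD1 i iJ) /=.
have -> : (c |: J) :\ i = c |: (J :\ i).
  apply/setP=> j; rewrite !inE; case: (j =P i) => //= ->.
  by rewrite orbF; apply/esym/eqP => e; rewrite e ltnn in lti.
by rewrite big_setU1 /= ?ltn_add2r // !inE (negPf cJ) andbF.
Qed.

End NbcSpan.

(** * Linear forms attached to flags of flats *)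

Section FlagFunctionals.
Variables (n : nat) (K : fieldType) (beta : 'I_n -> 'I_n -> K) (x0 : 'I_n).
Local Notation E := (qext beta).
Variables (M : matroid 'I_n) (chi : {set 'I_n} -> K).
Hypothesis chiM : is_chi_algebra beta M chi.
Implicit Types (I J U D : {set 'I_n}) (F : nat -> {set 'I_n}).

(** Dividing by [chi J] cancels the factor [chi] of the boundary coefficients, leaving an
    alternating sum of determinants. *)
Definition flag_functional k F : {linear E -> K^o} :=
  qmon_ext (W := K^o)
    (fun J => if #|J| == k then (chi J)^-1 * flag_det K x0 k F J else 0).

Lemma flag_functional_mon k F J : flag_functional k F (qmon beta J) =
  if #|J| == k then (chi J)^-1 * flag_det K x0 k F J else 0.
Proof. exact: qmon_ext_mon. Qed.

Lemma flag_functional_rel k F : (forall a, F a.+1 \subset F a) -> F k = set0 ->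
    (forall a, flat M (F a)) ->
  forall v, v \in rel_space beta M chi -> flag_functional k F v = 0.
Proof.
move=> nestF Fk0 flatF v vR.
have det0 J : dependent M J -> #|J| = k -> flag_det K x0 k F J = 0.
  case/andP=> sJ nJ cJ; apply/eqP; apply: contraNT nJ.
  exact: flag_det_indep.
apply/eqP; rewrite -memv0; move: v vR; apply: rel_space_map => [D dD|U dU].
  rewrite flag_functional_mon; case: eqP => [cD|_]; last exact: mem0v.
  by rewrite det0 // mulr0 mem0v.
rewrite memv0; apply/eqP; rewrite /chi_boundary linear_sum /=.
have cUp (p : 'I_#|U|) : #|U| = #|U :\ enum_val p|.+1.
  by rewrite (cardsD1 (enum_val p) U) enum_valP.
have [cU|cU] := eqVneq #|U| k.+1; last first.
  rewrite big1 // => p _; rewrite linearZ /= qprodE flag_functional_mon.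
  by rewrite ifN ?scaler0 // -eqSS -cUp.
have /andP[sU nU] := dU.
transitivity (- \sum_(p < #|U|) (-1) ^+ p * flag_det K x0 k F (U :\ enum_val p)).
  rewrite -sumrN; apply: eq_bigr => p _; rewrite linearZ /= qprodE flag_functional_mon.
  have cp : #|U :\ enum_val p| = k by apply: succn_inj; rewrite -cUp.
  rewrite cp eqxx -[_ *: _]/(_ * _) exprS mulN1r !mulNr; congr (- _).
  rewrite -mulrA; congr (_ * _).
  (* Where [chi] vanishes nothing can be cancelled, but the facet is then dependent and its
     determinant is zero as well. *)
  have [chi0|chi_n0] := eqVneq (chi (U :\ enum_val p)) 0; last by rewrite mulVKf.
  rewrite det0 ?mulr0 // dependentPn ?(subset_trans (subD1set _ _)) //.
  apply: contraTN (eqxx (0 : K)) => hI.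
  by have := chi_indep_neq0 chiM hI; rewrite chi0.
(* The cone is again a nested chain of flats, so its determinant vanishes on the dependent set
   [U]. *)
rewrite flag_det_boundary //; apply/eqP; rewrite oppr_eq0.
apply: contraNT nU; apply: flag_det_indep => //.
- by case=> [|a] /=; rewrite ?subsetT.
- by case=> [|a] //= J y _ _ _; rewrite inE.
Qed.

End FlagFunctionals.

Section NbcDuality.
Variables (n : nat) (K : fieldType) (x : 'I_n) (M : matroid 'I_n).
Implicit Types (I J : {set 'I_n}).
Hypothesis noloop : forall i, ~~ loop M i.

(** Closures are taken in [M], although [I] will have no broken circuit in [deletion M x]: the
    resulting form has to kill the relations of [M]. *)
Definition nbc_flag I a := mclosure M [set i in drop a (enum I)].

Lemma nbc_flag_nest I a : nbc_flag I a.+1 \subset nbc_flag I a.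
Proof.
apply: mclosureS; apply/subsetP=> i; rewrite !inE -[in drop a.+1 _]add1n -drop_drop.
exact: mem_drop.
Qed.

Lemma nbc_flag_last I : nbc_flag I #|I| = set0.
Proof.
rewrite /nbc_flag cardE drop_size -[RHS](mclosure0 noloop).
by congr mclosure; apply/setP=> i; rewrite !inE.
Qed.

Lemma drop_indep I a : indep M I -> indep M [set i in drop a (enum I)].
Proof.
apply: indep_subset; apply/subsetP=> i; rewrite inE => /mem_drop.
by rewrite mem_enum.
Qed.

Lemma nbc_flag_flat I a : indep M I -> flat M (nbc_flag I a).
Proof. by move=> hI; apply/mclosure_flat/drop_indep. Qed.

Lemma mem_drop_enum I a (b : nat) : (b < #|I|)%N ->
  (nth x (enum I) b \in drop a (enum I)) = (a <= b)%N.
Proof.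
rewrite cardE => ltb; apply/idP/idP => [|leab]; last first.
  by rewrite -(subnKC leab) -nth_drop mem_nth // size_drop ltn_sub2r // (leq_ltn_trans leab).
case/(nthP x)=> c; rewrite size_drop ltn_subRL nth_drop => ltc /eqP.
by rewrite nth_uniq ?enum_uniq // => /eqP <-; apply: leq_addr.
Qed.

Lemma nth_enum_set I (b : nat) : (b < #|I|)%N -> nth x (enum I) b \in I.
Proof. by move=> ltb; rewrite -mem_enum mem_nth // -cardE. Qed.

(** By independence the element of [I] at position [b] is in the closure of those from position [a]
    on exactly when [a <= b], so the matrix is unitriangular. *)
Lemma nbc_flag_det1 I : indep M I -> flag_det K x #|I| (nbc_flag I) I = 1.
Proof.
move=> hI; have sI := subsetP (indep_ground hI).
rewrite /flag_det -det_tr det_trig.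
  apply: big1 => a _; rewrite !mxE !inE mem_drop_enum // leqnn.
  by rewrite sI ?nth_enum_set.
apply/is_trig_mxP=> b a ltba; rewrite !mxE !inE mem_drop_enum // leqNgt ltba /=.
rewrite (@indep_subset _ M I) ?andbF //.
rewrite subUset sub1set nth_enum_set //=; apply/subsetP=> i; rewrite inE => /mem_drop.
by rewrite mem_enum.
Qed.

Lemma enum_drop_lt I (a : nat) (i : 'I_n) : (a < #|I|)%N ->
  i \in drop a.+1 (enum I) -> (nth x (enum I) a < i)%N.
Proof.
rewrite cardE => lta iI; have := sorted_enum_set I.
rewrite -[in sorted _ _](cat_take_drop a (enum I)) (drop_nth x lta) map_cat /=.
move/(subseq_sorted ltn_trans (suffix_subseq _ _)) => /= /(order_path_min ltn_trans).
by move/allP/(_ (val i)); apply; apply: map_f.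
Qed.

(* A nonzero flag determinant matches each [i_a] with some [j_a] in [J] spanning
   the same flat over [i_{a+1}, ..., i_k]. If [j_a != i_a], then the smaller of
   the two is spanned by larger elements of the nbc set containing the other. *)
Lemma nbc_flag_det_eq I J : nbc (deletion M x) I -> nbc (deletion M x) J ->
  #|J| = #|I| -> flag_det K x #|I| (nbc_flag I) J != 0 -> J = I.
Proof.
case/andP=> /andP[xI hI] /forall_inP nbI /andP[/andP[xJ hJ] /forall_inP nbJ] cJ.
case/(flag_det_perm (nbc_flag_nest I) (nbc_flag_last I)) => s sP.
have eqn (a : 'I_#|I|) : nth x (enum J) (s a) = nth x (enum I) a; last first.
  apply/esym/eqP; rewrite eqEcard cJ leqnn andbT; apply/subsetP=> i iI.
  have lt : (index i (enum I) < #|I|)%N by rewrite cardE index_mem mem_enum.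
  have := eqn (Ordinal lt); rewrite /= nth_index ?mem_enum // => <-.
  by rewrite nth_enum_set ?cJ.
(* Descending induction on [a]: the matching is already the identity beyond [a], so the tail [S]
   introduced below lies in both sets. *)
have [m] := ubnP (#|I| - a)%N; elim: m a => // m IH a ltm.
have {}IH (b : 'I_#|I|) : (a < b)%N -> nth x (enum J) (s b) = nth x (enum I) b.
  move=> ltab; apply: IH; rewrite -ltnS; apply: leq_trans ltm.
  by rewrite ltnS ltn_sub2l.
set i := nth x (enum I) a; set j := nth x (enum J) (s a).
pose S := [set i in drop a.+1 (enum I)].
have iI : i \in I by rewrite nth_enum_set.
have jJ : j \in J by rewrite nth_enum_set ?cJ.
have sSI : S \subset I.
  by apply/subsetP=> k; rewrite inE => /mem_drop; rewrite mem_enum.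
have sSJ : S \subset J.
  apply/subsetP=> k; rewrite inE => kS; have := mem_drop kS; rewrite mem_enum => kI.
  have lt : (index k (enum I) < #|I|)%N by rewrite cardE index_mem mem_enum.
  have := IH (Ordinal lt); rewrite /= nth_index ?mem_enum // => <-.
    by rewrite nth_enum_set ?cJ.
  by rewrite -(mem_drop_enum _ lt) nth_index ?mem_enum.
have ltS k : k \in S -> (i < k)%N by rewrite inE; apply: enum_drop_lt.
have eS : [set i in drop a (enum I)] = i |: S.
  rewrite (drop_nth x) -?cardE //; apply/setP=> k; rewrite !inE //.
(* The layer condition says that [j] is spanned by [i |: S] but not by [S]; for [j != i] this makes
   [S] with both [i] and [j] dependent. *)
have := sP a; rewrite -/j /nbc_flag eS inE -/S => /andP[jS].
rewrite inE => /andP[jM]; rewrite inE jM /= negb_or negbK in jS.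
case/andP: jS => jS hjS; rewrite in_setU1 (negPf jS) orbF.
case: eqP => //= ne dep.
have iJ : i \notin J.
  apply: contra dep => iJ; apply: indep_subset hJ.
  by rewrite !subUset !sub1set jJ iJ.
have jI : j \notin I.
  apply: contra dep => jI; apply: indep_subset hI.
  by rewrite !subUset !sub1set jI iI.
case: (ltngtP i j) => [ltij|ltji|/val_inj/esym//].
  have /andP[_] : indep (deletion M x) (i |: [set k in J | (i < k)%N]).
    apply: nbJ; rewrite !inE iJ (subsetP (indep_ground hI)) // andbT.
    by apply: contraNneq xI => <-.
  move/(indep_subset _) => h; case/negP: dep; apply: h; rewrite setUCA.
  apply: setUS; apply/subsetP=> k; rewrite !inE => /predU1P[->|kS].
    by rewrite jJ.
  have {}kS : k \in S by rewrite inE.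
  by rewrite (subsetP sSJ) //= ltS.
have /andP[_] : indep (deletion M x) (j |: [set k in I | (j < k)%N]).
  apply: nbI; rewrite !inE jI (subsetP (indep_ground hJ)) // andbT.
  by apply: contraNneq xJ => <-.
move/(indep_subset _) => h; case/negP: dep; apply: h.
apply: setUS; apply/subsetP=> k; rewrite !inE => /predU1P[->|kS].
  by rewrite iI.
have {}kS : k \in S by rewrite inE.
by rewrite (subsetP sSI) //= (ltn_trans ltji) ?ltS.
Qed.

End NbcDuality.

(** * Relations of [M] supported off [x] *)

Section DeletionIdeal.
Variables (n : nat) (K : fieldType) (beta : 'I_n -> 'I_n -> K).
Variables (M : matroid 'I_n) (chi : {set 'I_n} -> K) (x : 'I_n).
Hypothesis noloop : forall i, ~~ loop M i.
Hypothesis chiM : is_chi_algebra beta M chi.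

Lemma rel_space_deletion :
  (rel_space beta (deletion M x) chi <= rel_space beta M chi)%VS.
Proof.
apply: rel_space_sub => X; rewrite deletion_dependent => /andP[_].
  exact: rel_space_mon.
exact: rel_space_boundary.
Qed.

(** This is the injectivity of the inclusion: modulo relations of the deletion, [v] is a combination
    [w] of nbc monomials, and the forms of their flags show that [w] is zero. *)
Lemma rel_space_deletion_cap v : v \in rel_space beta M chi ->
    v \in gen_subalg beta (ground (deletion M x)) ->
  v \in rel_space beta (deletion M x) chi.
Proof.
move=> vR vG; have chiN := deletion_chi_algebra x chiM.
have := gen_subalg_ind (f := idfun) (nbc_span chiN) vG.
case/memv_addP=> r rR [w /qmon_spanP wP /= ev].
suff -> : v = r by [].
rewrite ev [w]qmon_expand big1 ?addr0 // => I _.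
have [nbI|nI] := boolP (nbc (deletion M x) I); last by rewrite wP ?scale0r.
have /andP[/andP[_ hI] _] := nbI.
(* This form kills [v] and [r], and among the nbc monomials it is nonzero at [I] only, so it
   isolates the coefficient [w I]. *)
pose f := flag_functional beta x chi #|I| (nbc_flag M I).
have fR u : u \in rel_space beta M chi -> f u = 0.
  apply: flag_functional_rel => //; first exact: nbc_flag_nest.
    exact: nbc_flag_last.
  by move=> a; apply: nbc_flag_flat.
have : f v = 0 by apply: fR.
rewrite ev linearD /= fR ?(subvP rel_space_deletion) // add0r.
rewrite linear_qmon (bigD1 I) //= big1 ?addr0 => [|J neJI].
  rewrite flag_functional_mon eqxx nbc_flag_det1 // mulr1 => /eqP.
  rewrite -[_ *: _]/(_ * _) mulf_eq0 invr_eq0.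
  by rewrite (negPf (chi_indep_neq0 chiM hI)) orbF => /eqP->; rewrite scale0r.
have [nbJ|nJ] := boolP (nbc (deletion M x) J); last by rewrite wP ?scale0r.
rewrite flag_functional_mon; case: eqP => [cJ|_]; last exact: scaler0.
have -> : flag_det K x #|I| (nbc_flag M I) J = 0.
  by apply/eqP; apply: contraNT neJI => nz; rewrite (nbc_flag_det_eq noloop nbI nbJ cJ nz).
by rewrite mulr0 scaler0.
Qed.

End DeletionIdeal.

(** * The exact sequence *)

Section QuotientSection.
Variables (K : fieldType) (V : vectType K) (J : {vspace V}).
Local Open Scope quotient_scope.

(** The chosen representative is not linear in [q]; removing its projection to [J] makes the result
    independent of the choice, hence linear. *)
Definition quotv_section (q : quotv J) : V := (\1 - projv J)%VF (generic_quotient.repr q).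

Lemma quotv_sectionK q : quotv_pi J (quotv_section q) = q.
Proof.
rewrite -[RHS]reprK; apply/quotv_piP; rewrite /quotv_section !lfun_simp addrAC subrr add0r.
by rewrite memvN memv_proj.
Qed.

Fact quotv_section_is_linear : linear quotv_section.
Proof.
move=> k p q; apply/eqP; rewrite -subr_eq0 /quotv_section -linearP -linearB /=.
set w := (X in fun_of_lfun _ X); suff wJ : w \in J by rewrite !lfun_simp projv_id ?subrr.
by apply/quotv_piP; rewrite linearP /= /quotv_pi !reprK.
Qed.

HB.instance Definition _ :=
  GRing.isLinear.Build K (quotv J) V _ quotv_section quotv_section_is_linear.

End QuotientSection.

Section ChiClasses.
Variables (n : nat) (K : fieldType) (beta : 'I_n -> 'I_n -> K).
Local Notation E := (qext beta).
Implicit Types (M : matroid 'I_n) (chi : {set 'I_n} -> K).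

Definition chi_pi M chi (v : E) : chi_alg beta M chi :=
  quotv_pi _ (vsproj (gen_subalg beta (ground M)) v).

Fact chi_pi_is_linear M chi : linear (chi_pi M chi).
Proof. by move=> k u v; rewrite /chi_pi !linearP. Qed.
HB.instance Definition _ M chi :=
  GRing.isLinear.Build K E (chi_alg beta M chi) _ (chi_pi M chi) (chi_pi_is_linear M chi).

Lemma chi_classE M chi X : chi_class beta M chi X = chi_pi M chi (qmon beta X).
Proof. by rewrite /chi_class qprodE. Qed.

Lemma chi_pi_eq0 M chi v : v \in gen_subalg beta (ground M) ->
  chi_pi M chi v = 0 <-> v \in chi_ideal beta M chi.
Proof.
move=> vG; rewrite /chi_pi -(linear0 (quotv_pi _)).
by split=> [/quotv_piP|h]; [|apply/quotv_piP];
  rewrite subr0 -memv_preim lfunE /= vsprojK.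
Qed.

Definition chi_repr M chi (q : chi_alg beta M chi) : E := vsval (quotv_section q).

Fact chi_repr_is_linear M chi : linear (@chi_repr M chi).
Proof. by move=> k u v; rewrite /chi_repr !linearP. Qed.
HB.instance Definition _ M chi :=
  GRing.isLinear.Build K (chi_alg beta M chi) E _ (@chi_repr M chi)
    (@chi_repr_is_linear M chi).

Lemma chi_repr_subalg M chi (q : chi_alg beta M chi) :
  chi_repr q \in gen_subalg beta (ground M).
Proof. exact: subvsP. Qed.

Lemma chi_reprK M chi : cancel (@chi_repr M chi) (chi_pi M chi).
Proof. by move=> q; rewrite /chi_pi /chi_repr vsvalK quotv_sectionK. Qed.

Lemma chi_map_lift M chi M' chi' (f : {linear E -> E}) :
    (forall v, v \in gen_subalg beta (ground M) ->
       f v \in gen_subalg beta (ground M')) ->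
    (forall v, v \in chi_ideal beta M chi -> f v \in chi_ideal beta M' chi') ->
  exists g : {linear chi_alg beta M chi -> chi_alg beta M' chi'},
    forall v, v \in gen_subalg beta (ground M) ->
      g (chi_pi M chi v) = chi_pi M' chi' (f v).
Proof.
move=> fG fJ; exists (chi_pi M' chi' \o (f \o @chi_repr M chi)) => v vG /=.
set u := chi_repr _; apply/eqP; rewrite -subr_eq0 -!linearB /=; apply/eqP.
have uG : u - v \in gen_subalg beta (ground M).
  by rewrite memvB ?chi_repr_subalg.
apply/chi_pi_eq0; first exact: fG.
by apply/fJ/chi_pi_eq0; rewrite // linearB /= chi_reprK subrr.
Qed.

Hypothesis beta_neq0 : forall i j : 'I_n, (i < j)%N -> beta i j != 0.

(** Dependent monomials lie in the ideal, so the classes of independent sets span the quotient. *)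
Lemma chi_alg_linear_ext M chi (W : lmodType K)
    (f g : {linear chi_alg beta M chi -> W}) :
    (forall i, ~~ loop M i) -> is_chi_algebra beta M chi ->
    (forall I, indep M I -> f (chi_class beta M chi I) = g (chi_class beta M chi I)) ->
  f =1 g.
Proof.
move=> noloop chiM efg q; rewrite -(chi_reprK q).
have /gen_subalgP qG := chi_repr_subalg q.
rewrite [chi_repr q]qmon_expand !linear_sum; apply: eq_bigr => X _ /=.
have [hX|nX] := boolP (indep M X).
  by rewrite !linearZ /= -chi_classE efg.
have [sX|nsX] := boolP (X \subset ground M); last first.
  by rewrite qG // scale0r !linear0.
rewrite (_ : chi_pi M chi _ = 0) ?linear0 //.
apply/chi_pi_eq0; first by rewrite memvZ ?qmon_gen_subalg.
by rewrite memvZ // chi_idealE // rel_space_mon // dependentPn.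
Qed.

End ChiClasses.

(** * Exactness and splitting *)

Section Sequence.
Variables (n : nat) (K : fieldType) (beta : 'I_n -> 'I_n -> K).
Local Notation E := (qext beta).
Hypothesis beta_neq0 : forall i j : 'I_n, (i < j)%N -> beta i j != 0.
Variables (M : matroid 'I_n) (chi : {set 'I_n} -> K) (x : 'I_n).
Hypothesis simpleM : simple_matroid M.
Hypothesis chiM : is_chi_algebra beta M chi.
Hypothesis xM : x \in ground M.

Let noloop : forall i, ~~ loop M i := simpleM.1.
Let indx : indep M [set x].
Proof. by have := simple_indep2 simpleM xM xM; rewrite setUid. Qed.

Let N := deletion M x.
Let Q := contraction M x.
Let noloopN : forall i, ~~ loop N i := deletion_loopless x noloop.
Let noloopQ : forall i, ~~ loop Q i := contraction_loopless indx simpleM.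
Let chiN : is_chi_algebra beta N chi := deletion_chi_algebra x chiM.
Let chiQ : is_chi_algebra beta Q (contr_chi chi x) :=
  contraction_chi_algebra beta_neq0 indx chiM.

Let idealM : chi_ideal beta M chi = rel_space beta M chi.
Proof. exact: chi_idealE. Qed.
Let idealN : chi_ideal beta N chi = rel_space beta N chi.
Proof. exact: chi_idealE. Qed.
Let idealQ : chi_ideal beta Q (contr_chi chi x) = rel_space beta Q (contr_chi chi x).
Proof. exact: chi_idealE. Qed.

Lemma gen_subalgS (S S' : {set 'I_n}) v : S \subset S' ->
  v \in gen_subalg beta S -> v \in gen_subalg beta S'.
Proof.
move=> sS /gen_subalgP vS; apply/gen_subalgP=> X nX; apply: vS.
by apply: contra nX => sX; apply: subset_trans sS.
Qed.

Lemma residue_subalg v : v \in gen_subalg beta (ground M) ->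
  residue beta x v \in gen_subalg beta (ground Q).
Proof.
apply: gen_subalg_ind => X sX; rewrite residue_mon; case: ifP => _; last exact: mem0v.
by rewrite qmon_gen_subalg // setSD.
Qed.

Lemma coresidue_subalg v : v \in gen_subalg beta (ground Q) ->
  coresidue beta x v \in gen_subalg beta (ground M).
Proof.
apply: gen_subalg_ind => X; rewrite /= subsetD1 => /andP[sX _].
rewrite coresidue_mon; case: ifP => _; first exact: mem0v.
by rewrite qmon_gen_subalg // subUset sub1set xM.
Qed.

Lemma residue_rel v : v \in rel_space beta M chi ->
  residue beta x v \in rel_space beta Q (contr_chi chi x).
Proof.
apply: rel_space_map => [D dD|U dU].
  rewrite residue_mon; case: ifP => xD; last exact: mem0v.
  by apply: rel_space_mon; rewrite contraction_dependent // setD11 setD1K.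
have [xU|xU] := boolP (x \in U).
  rewrite -(setD1K xU) residue_boundary ?setD11 //; apply/memvZ/rel_space_boundary.
  by rewrite contraction_dependent // setD11 setD1K.
rewrite chi_boundaryE linear_sum; apply: rpred_sum => i iU.
by rewrite linearZ /= residue_mon inE (negPf xU) andbF scaler0 mem0v.
Qed.

(** Only the facets dropping [x] keep [coresidue] from preserving relations; their monomials are the
    second summand. *)
Lemma coresidue_rel v : v \in rel_space beta Q (contr_chi chi x) ->
  coresidue beta x v \in (rel_space beta M chi + gen_subalg beta (ground N))%VS.
Proof.
apply: rel_space_map => [D|U]; rewrite contraction_dependent // => /andP[xX dX].
  rewrite coresidue_mon (negPf xX); apply: subvP (addvSl _ _) _ _.
  exact: rel_space_mon.
rewrite coresidue_boundary // memvZ // memvB //.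
  by apply: subvP (addvSl _ _) _ _; apply: rel_space_boundary.
apply: subvP (addvSr _ _) _ _; apply/memvZ/qmon_gen_subalg.
by case/andP: dX => sX _; rewrite /= subsetD1 xX andbT (subset_trans (subsetUr _ _) sX).
Qed.

Lemma residueK v : v \in gen_subalg beta (ground M) ->
  v - coresidue beta x (residue beta x v) \in gen_subalg beta (ground N).
Proof.
move=> /gen_subalgP vG; have := linear_qmon (coresidue beta x \o residue beta x : {linear E -> E}) v.
rewrite /= => ->; rewrite {1}[v]qmon_expand -sumrB.
apply: rpred_sum => X _; rewrite -scalerBr.
have [sX|nX] := boolP (X \subset ground M); last by rewrite vG // scale0r mem0v.
apply: memvZ; rewrite residue_mon; case: ifPn => xX.
  by rewrite coresidue_mon setD11 setD1K // subrr mem0v.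
by rewrite linear0 subr0 qmon_gen_subalg //= subsetD1 sX.
Qed.

Lemma coresidueK v : v \in gen_subalg beta (ground Q) ->
  residue beta x (coresidue beta x v) = v.
Proof.
move=> /gen_subalgP vG; have := linear_qmon (residue beta x \o coresidue beta x : {linear E -> E}) v.
rewrite /= => ->; rewrite [RHS]qmon_expand; apply: eq_bigr => X _.
have [sX|nX] := boolP (X \subset ground Q); last by rewrite vG // !scale0r.
move: sX; rewrite /= subsetD1 => /andP[_ xX].
by rewrite coresidue_mon (negPf xX) residue_mon setU11 setU1K.
Qed.

Lemma residue_deletion v : v \in gen_subalg beta (ground N) -> residue beta x v = 0.
Proof.
move=> /gen_subalgP vG; rewrite linear_qmon big1 // => X _.
have [xX|xX] := boolP (x \in X); last by rewrite residue_mon (negPf xX) scaler0.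
by rewrite vG ?scale0r //= subsetD1 xX andbF.
Qed.

Lemma inclusion_exists : exists i : {linear del_alg beta M chi x -> chi_alg beta M chi},
  forall v, v \in gen_subalg beta (ground N) -> i (chi_pi N chi v) = chi_pi M chi v.
Proof.
apply: (@chi_map_lift _ _ _ N chi M chi idfun) => v /=.
  by apply: gen_subalgS; apply: subD1set.
by rewrite idealN idealM; apply: subvP; apply: rel_space_deletion.
Qed.

Lemma projection_exists :
  exists p : {linear chi_alg beta M chi -> contr_alg beta M chi x},
  forall v, v \in gen_subalg beta (ground M) ->
    p (chi_pi M chi v) = chi_pi Q (contr_chi chi x) (residue beta x v).
Proof.
apply: chi_map_lift => v; first exact: residue_subalg.
by rewrite idealM idealQ; apply: residue_rel.
Qed.

Lemma inclusionP (i : {linear del_alg beta M chi x -> chi_alg beta M chi}) :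
  is_inclusion i <-> forall v, v \in gen_subalg beta (ground N) ->
    i (chi_pi N chi v) = chi_pi M chi v.
Proof.
split=> [incl v vG|ei I hI]; last first.
  rewrite !chi_classE -[deletion M x]/N ei // qmon_gen_subalg //.
  exact: (indep_ground hI).
have [j ej] := inclusion_exists; rewrite -ej //.
apply: (chi_alg_linear_ext beta_neq0 noloopN chiN) => I hI.
rewrite [LHS]incl // !chi_classE ej // qmon_gen_subalg //.
exact: (indep_ground hI).
Qed.

Lemma projectionP (p : {linear chi_alg beta M chi -> contr_alg beta M chi x}) :
  is_projection p <-> forall v, v \in gen_subalg beta (ground M) ->
    p (chi_pi M chi v) = chi_pi Q (contr_chi chi x) (residue beta x v).
Proof.
have nopar y : ~~ parallel M x y := simpleM.2 x y.
have eqI (q : {linear chi_alg beta M chi -> contr_alg beta M chi x}) :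
    (forall v, v \in gen_subalg beta (ground M) ->
      q (chi_pi M chi v) = chi_pi Q (contr_chi chi x) (residue beta x v)) ->
    forall I, indep M I -> q (chi_class beta M chi I) =
      if x \in I then chi_class beta Q (contr_chi chi x) (I :\ x) else 0.
  move=> eq I hI; rewrite chi_classE eq ?qmon_gen_subalg ?(indep_ground hI) //.
  by rewrite residue_mon chi_classE; case: ifP => // _; rewrite linear0.
split=> [proj v vG|/eqI ep I hI]; last first.
  split=> [xI|y _ _|xI _]; first by rewrite ep // xI.
    (* Simplicity excludes an element parallel to [x]. *)
    by rewrite (negPf (nopar y)).
  by rewrite ep // (negPf xI).
have [q eq] := projection_exists; rewrite -eq //.
apply: (chi_alg_linear_ext beta_neq0 noloop chiM) => I hI.
rewrite (eqI _ eq) //; have [p1 _ p3] := proj I hI.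
by case: ifPn => xI; [rewrite p1 | rewrite p3].
Qed.

Lemma inclusion_projection_split
    (i : {linear del_alg beta M chi x -> chi_alg beta M chi})
    (p : {linear chi_alg beta M chi -> contr_alg beta M chi x}) :
  is_inclusion i -> is_projection p -> split_short_exact i p.
Proof.
move=> /inclusionP ei /projectionP ep.
have sNM v : v \in gen_subalg beta (ground N) -> v \in gen_subalg beta (ground M).
  by apply: gen_subalgS; apply: subD1set.
pose s : {linear contr_alg beta M chi x -> chi_alg beta M chi} :=
  chi_pi M chi \o (coresidue beta x \o @chi_repr _ _ beta Q (contr_chi chi x)).
have ps w : p (s w) = w.
  have wG := chi_repr_subalg (w : chi_alg beta Q (contr_chi chi x)).
  rewrite /s /= ep ?coresidue_subalg // coresidueK //.
  exact: chi_reprK.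
split; last by exists s.
(* A representative without [x] that is a relation of [M] is already a relation of the deletion. *)
- apply: raddf_inj => u iu0; have uK := @chi_reprK _ _ beta N chi u.
  have uG := chi_repr_subalg (u : chi_alg beta N chi).
  have := ei _ uG; rewrite uK [LHS]iu0 => /esym/(chi_pi_eq0 chi (sNM _ uG)).
  rewrite idealM => uR; rewrite -uK; apply/(chi_pi_eq0 chi uG); rewrite idealN.
  exact: rel_space_deletion_cap.
- move=> v; split=> [|[u ->]]; last first.
    rewrite -[u](@chi_reprK _ _ beta N chi).
    have uG := chi_repr_subalg (u : chi_alg beta N chi).
    by rewrite ei // ep ?sNM // residue_deletion // linear0.
  rewrite -[v]chi_reprK; have vG := chi_repr_subalg v; set w := chi_repr v in vG *.
  rewrite ep // => /(chi_pi_eq0 _ (residue_subalg vG)).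
  rewrite idealQ => /coresidue_rel /memv_addP[r rR [g gN ew]].
  (* The part of [w] involving [x] equals [r + g], with [r] a relation and [g] free of [x].
     Replacing this part by [g] gives a preimage, as [w - u = r]. *)
  pose u := g + (w - coresidue beta x (residue beta x w)).
  have uN : u \in gen_subalg beta (ground N) by rewrite memvD // residueK.
  exists (chi_pi N chi u); rewrite ei //; apply/eqP; rewrite -subr_eq0 -linearB /=.
  have -> : w - u = r.
    by rewrite /u ew opprD opprB addrCA [w + _]addrC subrK addrC addrK.
  apply/eqP/chi_pi_eq0; last by rewrite idealM.
  exact: (subvP (rel_space_subalg beta M chi) _ rR).
- by move=> w; exists (s w).
Qed.

End Sequence.

Theorem theorem2p7 (n : nat) (K : fieldType) (beta : 'I_n -> 'I_n -> K)
    (beta_neq0 : forall i j : 'I_n, (i < j)%N -> beta i j != 0)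
    (M : matroid 'I_n) (groundM : ground M = [set: 'I_n])
    (simpleM : simple_matroid M)
    (chi : {set 'I_n} -> K) (chiM : is_chi_algebra beta M chi) (x : 'I_n) :
  [/\ unique_linear (@is_inclusion n K beta M chi x),
      unique_linear (@is_projection n K beta M chi x)
    & forall (i : {linear del_alg beta M chi x -> chi_alg beta M chi})
             (p : {linear chi_alg beta M chi -> contr_alg beta M chi x}),
        is_inclusion i -> is_projection p -> split_short_exact i p].
Proof.
have xM : x \in ground M by rewrite groundM inE.
split.
- have [i ei] := inclusion_exists beta_neq0 x simpleM chiM.
  exists i; first exact/inclusionP.
  move=> g /(inclusionP beta_neq0 simpleM chiM) eg q.
  rewrite -[q](@chi_reprK _ _ beta (deletion M x) chi).
  have qG := chi_repr_subalg (q : chi_alg beta (deletion M x) chi).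
  by rewrite eg // ei.
- have [p ep] := projection_exists beta_neq0 simpleM chiM xM.
  exists p; first exact/projectionP.
  move=> g /(projectionP beta_neq0 simpleM chiM xM) eg q.
  rewrite -[q]chi_reprK; have qG := chi_repr_subalg q.
  by rewrite eg // ep.
- exact: inclusion_projection_split.
Qed.
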